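(* Let $d\ge 1$ and let $\{M_k\}_{k\ge1}$, $\{N_k\}_{k\ge1}$ be sequences of integers with $M_k\ge 2$ and $1\le N_k\le M_k^d$ for all $k$. Let $\Omega=\Omega(M_k,N_k)$ be the associated space of random Cantor sets $E\subset[0,1]^d$ with its probability measure $\mathbb{P}$, let $\mu$ denote the natural measure on $E$, and let $t^*, s_1, s^*, s_2, s^{**}$ be the numbers defined in the context. Then: (1) For any $E\in\Omega$ and $x\in E$, $t^{*}\le\underline{\dim}(\mu,x)\le s_1$. (2) For any $E\in\Omega$ and $x\in E$, $s^{*}\le\overline{\dim}(\mu,x)\le s^{**}$. (3) For $\mathbb{P}$-almost all $E\in\Omega$ and $\mu$-almost every $x\in E$, $\underline{\dim}(\mu,x)=s_1$. (4) For $\mathbb{P}$-almost all $E\in\Omega$ and $\mu$-almost every $x\in E$, $\overline{\dim}(\mu,x)=s_2$.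
   Context: Notation: $P_n=\prod_{i=1}^n N_i$, $r_n=\big(\prod_{i=1}^n M_i\big)^{-1}$, $p_n=P_nr_n^d$. $\mathcal{D}_n$ is the family of closed cubes $\prod_{\ell=1}^d[i_\ell r_n,(i_\ell+1)r_n]$ with integers $0\le i_\ell\le r_n^{-1}-1$. Random Cantor sets: divide $[0,1]^d$ into the $M_1^d$ cubes of $\mathcal{D}_1$ and choose $N_1$ distinct ones uniformly at random without replacement; $E_1$ is their union. Given $E_n$ (a union of $P_n$ cubes of $\mathcal{D}_n$), divide each chosen cube of $E_n$ into $M_{n+1}^d$ cubes of $\mathcal{D}_{n+1}$ and choose $N_{n+1}$ distinct ones uniformly at random without replacement, independently for different cubes of $E_n$; $E_{n+1}$ is the union of all chosen cubes. Put $E=\bigcap_{n\ge1}E_n$. $\Omega$ consists of all possible outcomes (realizations), and $\mathbb{P}$ is the resulting probability; ''any $E\in\Omega$'' means every possible outcome. Natural measure: for a realization $E=\bigcap_nE_n$ let $\mu_n(A)=\int \mathbf{1}_{A\cap E_n}(x)\,p_n^{-1}\,dx$. The measures $\mu_n$ converge weakly to a measure $\mu$, called the natural measure on $E$ (it is the one attached to the given realization $(E_n)_n$). Local dimensions: $\underline{\dim}(\mu,x)=\liminf_{r\to0}\frac{\log\mu(B(x,r))}{\log r}$, $\overline{\dim}(\mu,x)=\limsup_{r\to0}\frac{\log\mu(B(x,r))}{\log r}$. Numbers: $$s_1=\liminf_{n\to\infty}\frac{\log P_n}{-\log r_n},\quad s_2=\limsup_{n\to\infty}\frac{\log P_{n+1}}{-\log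 r_n+\frac1d\log N_{n+1}},\quad t^*=\liminf_{n\to\infty}\frac{\log P_n}{-\log r_{n+1}-\frac1d\log N_{n+1}},$$ $$s^*=\limsup_{n\to\infty}\frac{\log P_n}{-\log r_n},\quad s^{**}=\limsup_{n\to\infty}\frac{\log P_{n+1}}{-\log r_n}.$$ *)

(* Defs.v *)
From HB Require Import structures.
From mathcomp Require Import all_boot all_order all_algebra.
From mathcomp Require Import all_classical all_reals all_analysis.

Set Implicit Arguments.
Unset Strict Implicit.
Unset Printing Implicit Defensive.

Import Order.TTheory GRing.Theory Num.Theory.
Import numFieldNormedType.Exports.

Local Open Scope classical_set_scope.
Local Open Scope ring_scope.

(** * Realizations

    The sequences [M] and [N] are indexed from 1; [M 0] and [N 0] never occur. *)

(* [res M n] is r_n^-1, the number of cubes of D_n along each side. *)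
Definition res (M : nat -> nat) (n : nat) : nat := \prod_(1 <= i < n.+1) M i.

Definition nb_cubes (N : nat -> nat) (n : nat) : nat :=
  \prod_(1 <= i < n.+1) N i.

(* The index (i_1, ..., i_d) of a cube of D_n; D_0 = {[0,1]^d}. *)
Definition cube (d : nat) (M : nat -> nat) (n : nat) : finType :=
  {ffun 'I_d -> 'I_(res M n)}.

(* The cubes of D_(n+1) into which [Q] is divided: those of index j with
   i_l M_(n+1) <= j_l < (i_l + 1) M_(n+1) for all l, where i is the index of [Q]. *)
Definition children (d : nat) (M : nat -> nat) (n : nat) (Q : cube d M n) :
    {set cube d M n.+1} :=
  [set Q' : cube d M n.+1 | [forall l, Q' l %/ M n.+1 == Q l :> nat]%N]%SET.

(* [E n] is the set of cubes of D_n whose union is E_n. *)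
Definition realization (d : nat) (M N : nat -> nat)
    (E : forall n, {set cube d M n}) : Prop :=
  E 0%N = [set: cube d M 0]%SET /\
  forall n, E n.+1 \subset (\bigcup_(Q in E n) children Q)%SET /\
    forall Q, Q \in E n -> #|E n.+1 :&: children Q| = N n.+1.

Section outcome_inhabited.
Variables (d : nat) (M N : nat -> nat).
Hypothesis hN : forall k, (1 <= k)%N -> (1 <= N k <= M k ^ d)%N.

Lemma resS n : res M n.+1 = (res M n * M n.+1)%N.
Proof. by rewrite /res big_nat_recr. Qed.

Fact child_subproof n (Q : cube d M n) (c : {ffun 'I_d -> 'I_(M n.+1)}) l :
  (Q l * M n.+1 + c l < res M n.+1)%N.
Proof.
rewrite resS (@leq_trans ((Q l).+1 * M n.+1)) ?leq_mul2r ?ltn_ord ?orbT//.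
by rewrite mulSn addnC ltn_add2r.
Qed.

Lemma card_children n (Q : cube d M n) : #|children Q| = (M n.+1 ^ d)%N.
Proof.
pose f (c : {ffun 'I_d -> 'I_(M n.+1)}) : cube d M n.+1 :=
  [ffun l => Ordinal (child_subproof Q c l)].
have finj : injective f.
  move=> c c' /ffunP e; apply/ffunP => l; apply: val_inj.
  by have := congr1 (@nat_of_ord _) (e l); rewrite !ffunE /= => /addnI.
suff -> : children Q = [set f c | c in {: {ffun 'I_d -> 'I_(M n.+1)}}]%SET.
  by rewrite card_imset// card_ffun card_ord [X in (_ ^ X)%N]card_ord.
apply/setP => Q'; rewrite inE; apply/forallP/imsetP => [h|[c _ ->] l].
  have M0 (l : 'I_d) : (0 < M n.+1)%N.
    have := ltn_ord (Q' l); rewrite [X in (_ < X)%N]resS lt0n.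
    by case: eqP => // ->; rewrite muln0.
  exists [ffun l => Ordinal (ltn_pmod (Q' l) (M0 l))] => //.
  apply/ffunP => l; apply: val_inj; rewrite !ffunE /= -(eqP (h l)) ffunE /=.
  exact: divn_eq.
have cM := ltn_ord (c l).
by rewrite ffunE /= divnMDl ?(leq_ltn_trans _ cM)// divn_small ?addn0.
Qed.

Lemma realization_exists :
  {E : forall n, {set cube d M n} | realization N E}.
Proof.
pose g n (Q : cube d M n) : {set cube d M n.+1} :=
  [set Q' in take (N n.+1) (enum (children Q))]%SET.
have gsub n Q : g n Q \subset children Q.
  by apply/fintype.subsetP => Q'; rewrite inE => /mem_take; rewrite mem_enum.
have gcard n Q : #|g n Q| = N n.+1.
  rewrite cardsE (card_uniqP _) ?take_uniq ?enum_uniq//.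
  apply: size_takel; rewrite -cardE card_children.
  by have /andP[] := hN (ltn0Sn n).
pose E := fix E n : {set cube d M n} :=
  if n is n'.+1 then (\bigcup_(Q in E n') g n' Q)%SET else [set: cube d M 0]%SET.
exists E; split=> // n; split.
  by apply/fintype.subsetP => Q' /finset.bigcupP[Q QE /(fintype.subsetP (gsub n Q)) Q'Q];
     apply/finset.bigcupP; exists Q.
move=> Q QE; rewrite -(gcard n Q); apply: eq_card => Q'.
rewrite !inE; apply/andP/idP => [[/finset.bigcupP[Q2 Q2E Q'Q2] /forallP h]|Q'Q].
  suff -> : Q = Q2 by move: Q'Q2; rewrite inE.
  apply/ffunP => l; apply: val_inj; rewrite /= -(eqP (h l)).
  by have := fintype.subsetP (gsub n Q2) _ Q'Q2; rewrite inE => /forallP/(_ l)/eqP.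
have {}Q'Q : Q' \in g n Q by rewrite inE.
split; first by apply/finset.bigcupP; exists Q.
by have := fintype.subsetP (gsub n Q) _ Q'Q; rewrite inE.
Qed.

End outcome_inhabited.

(** * The probability space

    A measurable type has to be inhabited, hence the argument [hN]. *)

Definition outcome (d : nat) (M N : nat -> nat)
    (hN : forall k, (1 <= k)%N -> (1 <= N k <= M k ^ d)%N) : Type :=
  {E : forall n, {set cube d M n} | realization N E}.

HB.instance Definition _ d M N hN := gen_eqMixin (@outcome d M N hN).
HB.instance Definition _ d M N hN := gen_choiceMixin (@outcome d M N hN).
HB.instance Definition _ d M N hN :=
  isPointed.Build (@outcome d M N hN) (realization_exists hN).

Definition cylinders (d : nat) (M N : nat -> nat)
    (hN : forall k, (1 <= k)%N -> (1 <= N k <= M k ^ d)%N) :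
    set (set (outcome hN)) :=
  [set C | exists n (A : {set cube d M n}), C = [set E | sval E n = A]].

Definition Omega (d : nat) (M N : nat -> nat)
    (hN : forall k, (1 <= k)%N -> (1 <= N k <= M k ^ d)%N) :=
  g_sigma_algebraType (@cylinders d M N hN).

Section law.
Variables (R : realType) (d : nat) (M N : nat -> nat).
Hypothesis hN : forall k, (1 <= k)%N -> (1 <= N k <= M k ^ d)%N.

(* The first n construction steps have the outcome prescribed by [A]. *)
Definition history (A : Omega hN) (n : nat) : set (Omega hN) :=
  [set E | forall k, (k <= n)%N -> sval E k = sval A k].

(* Given the first n steps, the sets of subcubes chosen in the different cubes
   of E_n are independent, and each of them is uniform among the sets of
   N_(n+1) subcubes of the cube in question. This determines [P]. *)
Definition random_cantor_law (P : probability (Omega hN) R) : Prop :=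
  forall (n : nat) (A : Omega hN) (B : cube d M n -> {set cube d M n.+1}),
    (forall Q, Q \in sval A n ->
       B Q \subset children Q /\ #|B Q| = N n.+1) ->
    P (history A n `&`
         [set E | forall Q, Q \in sval A n ->
                    (sval E n.+1 :&: children Q)%SET = B Q]) =
    (P (history A n) *
       (\prod_(Q in sval A n) ('C(M n.+1 ^ d, N n.+1)%:R^-1 : R))%:E)%E.

End law.

(** * Euclidean space *)

(* R^d with its Borel sigma-algebra. *)
Definition Rn (R : realType) (d : nat) :=
  g_sigma_algebraType (@open 'rV[R]_d).

(* d-dimensional Lebesgue measure, as an iterated product measure. *)
Fixpoint lebesgue_Rn (R : realType) (d : nat) : set (Rn R d) -> \bar R :=
  match d with
  | 0%N => \d_(0 : Rn R 0)
  | d'.+1 =>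
      pushforward (@lebesgue_measure R \x @lebesgue_Rn R d')%E
        (fun p : R * Rn R d' => row_mx p.1%:M p.2 : Rn R d'.+1)
  end.

Definition cball (R : realType) (d : nat) (x : Rn R d) (r : R) : set (Rn R d) :=
  [set y | Num.sqrt (\sum_(i < d) (y ord0 i - x ord0 i) ^+ 2) <= r].

Section natural_measure.
Variables (R : realType) (d : nat) (M N : nat -> nat).
Hypothesis hN : forall k, (1 <= k)%N -> (1 <= N k <= M k ^ d)%N.
Implicit Types E : Omega hN.

Definition side (n : nat) : R := (res M n)%:R^-1.

Definition density (n : nat) : R := (nb_cubes N n)%:R * side n ^+ d.

Definition cube_set (n : nat) (Q : cube d M n) : set (Rn R d) :=
  [set x | forall l : 'I_d,
     (Q l)%:R * side n <= x ord0 l <= (Q l).+1%:R * side n].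

Definition level_set E (n : nat) : set (Rn R d) :=
  \bigcup_(Q in [set Q | Q \in sval E n]) cube_set Q.

Definition cantor_set E : set (Rn R d) :=
  \bigcap_(n in [set n | (1 <= n)%N]) level_set E n.

Definition mu_n E (n : nat) (A : set (Rn R d)) : \bar R :=
  (\int[@lebesgue_Rn R d]_x
     (\1_(A `&` level_set E n) x * (density n)^-1)%:E)%E.

(* [mu] is the weak limit of the measures mu_n; this determines [mu]. *)
Definition natural_measure E (mu : {measure set (Rn R d) -> \bar R}) : Prop :=
  forall f : 'rV[R]_d -> R, continuous f ->
    (exists K : R, forall x, `|f x| <= K) ->
    (\int[mu_n E n]_(x in [set: Rn R d]) (f x)%:E)%E @[n --> \oo] -->
    (\int[mu]_(x in [set: Rn R d]) (f x)%:E)%E.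

End natural_measure.

(** * Dimensions *)

Section local_dimension.
Variables (R : realType) (d : nat).

Definition lower_dim (mu : set (Rn R d) -> \bar R) (x : Rn R d) : \bar R :=
  limf_einf (fun r : R => lne (mu (cball x r)) * ((ln r)^-1)%:E)%E (0^'+).

Definition upper_dim (mu : set (Rn R d) -> \bar R) (x : Rn R d) : \bar R :=
  limf_esup (fun r : R => lne (mu (cball x r)) * ((ln r)^-1)%:E)%E (0^'+).

End local_dimension.

(* These are extended reals: [s_starstar] can be +oo when [M] is unbounded. *)
Section numbers.
Variables (R : realType) (d : nat) (M N : nat -> nat).

Let lnP n : R := ln (nb_cubes N n)%:R.
Let lnr n : R := ln (side R M n).
Let lnN n : R := ln (N n)%:R.

Definition s_1 : \bar R := limn_einf (fun n => (lnP n / - lnr n)%:E).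

Definition s_2 : \bar R :=
  limn_esup (fun n => (lnP n.+1 / (- lnr n + d%:R^-1 * lnN n.+1))%:E).

Definition t_star : \bar R :=
  limn_einf (fun n => (lnP n / (- lnr n.+1 - d%:R^-1 * lnN n.+1))%:E).

Definition s_star : \bar R := limn_esup (fun n => (lnP n / - lnr n)%:E).

Definition s_starstar : \bar R :=
  limn_esup (fun n => (lnP n.+1 / - lnr n)%:E).

End numbers.

(* Main.v *)
(* Write rho_n = -log r_n, L_n = log P_n and H(rho) = -log mu(B(x, e^-rho)); the
   local dimensions at x are the lower and upper limits of H(rho) / rho.
   Comparing mu with mu_n through continuous cut-offs shows that a cube of E_n
   has mass of order 1 / P_n, and counting cubes then gives (1) and (2): for
   every x in E, H(rho_n) is L_n up to a bounded error, and a ball of radius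
   r >= r_n has mass at most C (r / r_n)^d / P_n.

   Parts (3) and (4) rest on the fact that, for r_(n+1) <= r <= r_n, mu(B(x, r))
   typically is max(1 / P_(n+1), (r / r_n)^d / P_n) up to a factor subexponential
   in log (1 / r). For the lower bound no randomness is needed: if a cube of E_n is cut
   into subcubes of side r, the subcubes with much less than the average mass
   carry little mass in total. For the upper bound, two cubes of D_(n+1) are
   jointly selected with probability at most (N_(n+1) / M_(n+1)^d)^2, so the
   expected number of pairs of cubes of E_(n+1) at distance at most r is at most
   P_(n+1) (1 + C (r / r_(n+1))^d N_(n+1) / M_(n+1)^d). Both bounds are applied
   at the dyadic radii r = 2^-m and combined with the Borel-Cantelli lemma. On
   [rho_n, rho_(n+1)] the resulting profile of H(rho) / rho increases up to
   rho_n + (log N_(n+1)) / d and decreases afterwards, which yields s_1 as lower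
   limit and s_2 as upper limit. *)
Require Import Defs.
From HB Require Import structures.
From mathcomp Require Import all_boot all_order all_algebra.
From mathcomp Require Import all_classical all_reals all_analysis.
From mathcomp Require Import measurable_realfun zify ring lra.

Set Implicit Arguments.
Unset Strict Implicit.
Unset Printing Implicit Defensive.

Import Order.TTheory GRing.Theory Num.Theory.
Import numFieldNormedType.Exports.

Local Open Scope classical_set_scope.
Local Open Scope ring_scope.

(** * Realizations *)

Section realizations.
Variables (d : nat) (M N : nat -> nat).

Fact parent_subproof n (Q : cube d M n.+1) l : (Q l %/ M n.+1 < res M n)%N.
Proof.
have := ltn_ord (Q l); rewrite [X in (_ < X)%N]resS.
by case: (posnP (M n.+1)) => [->|M0]; [rewrite muln0|rewrite ltn_divLR].
Qed.

Definition parent n (Q : cube d M n.+1) : cube d M n :=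
  [ffun l => Ordinal (parent_subproof Q l)].

Lemma in_children n (Q : cube d M n) (Q' : cube d M n.+1) :
  (Q' \in children Q) = (parent Q' == Q).
Proof.
rewrite inE; apply/forallP/eqP => [h|<- l]; last by rewrite ffunE.
by apply/ffunP => l; apply: val_inj; rewrite ffunE /=; apply/eqP/h.
Qed.

Lemma nb_cubesS n : nb_cubes N n.+1 = (nb_cubes N n * N n.+1)%N.
Proof. by rewrite /nb_cubes big_nat_recr. Qed.

Lemma res0 : res M 0 = 1%N. Proof. by rewrite /res big_geq. Qed.

Lemma nb_cubes0 : nb_cubes N 0 = 1%N. Proof. by rewrite /nb_cubes big_geq. Qed.

Variable E : forall n, {set cube d M n}.
Hypothesis hE : realization N E.

Lemma parent_in n Q : Q \in E n.+1 -> parent Q \in E n.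
Proof.
have [/fintype.subsetP sE _] := hE.2 n; move=> /sE/finset.bigcupP[Q' Q'E].
by rewrite in_children => /eqP ->.
Qed.

(** Each chosen cube has exactly [N n.+1] chosen children, so the fibres of [parent] over [E n] all
    have the same size. *)
Lemma card_parent n (p : pred (cube d M n)) :
  #|[set Q' in E n.+1 | p (parent Q')]%SET| =
  (N n.+1 * #|[set Q in E n | p Q]%SET|)%N.
Proof.
have [_ cE] := hE.2 n.
rewrite -sum1_card (partition_big (@parent n) (mem [set Q in E n | p Q]%SET)).
  rewrite (eq_bigr (fun=> N n.+1)); first by rewrite sum_nat_const mulnC.
  move=> Q QpE; have /andP[QE pQ] : (Q \in E n) && p Q.
    by move: QpE; rewrite !inE.
  rewrite -(cE Q QE) -sum1_card; apply: eq_bigl => Q'.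
  rewrite finset.in_setI in_children inE; case: eqP => [->|]; last by rewrite !andbF.
  by rewrite pQ !andbT.
by move=> Q' /=; rewrite !inE => /andP[/parent_in -> ->].
Qed.

Lemma card_realization n : #|E n| = nb_cubes N n.
Proof.
elim: n => [|n IHn].
  by rewrite nb_cubes0 hE.1 cardsT card_ffun !card_ord res0 exp1n.
have := @card_parent n predT; rewrite nb_cubesS mulnC -IHn => e.
rewrite -[in RHS](_ : [set Q in E n | predT Q]%SET = E n) -?e.
  by congr #|pred_of_set _|; apply/setP => Q; rewrite inE andbT.
by apply/setP => Q; rewrite inE andbT.
Qed.

(** If children inherit [p], the proportion of cubes of [E n] with [p] can only grow with [n]; the
    fractions are cross-multiplied. Used for cubes contained in a ball. *)
Lemma leq_card_realization (p : forall n, pred (cube d M n)) n m : (n <= m)%N ->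
  (forall k Q, p k (parent Q) -> p k.+1 Q) ->
  (#|[set Q in E n | p n Q]%SET| * nb_cubes N m <=
   #|[set Q in E m | p m Q]%SET| * nb_cubes N n)%N.
Proof.
move=> + pS; elim: m => [|m IHm]; first by rewrite leqn0 => /eqP->.
rewrite leq_eqVlt => /orP[/eqP->//|/IHm {}IHm].
rewrite nb_cubesS mulnA (leq_trans (leq_mul IHm (leqnn _)))//.
rewrite mulnAC leq_mul// mulnC -card_parent subset_leq_card//.
by apply/fintype.subsetP => Q; rewrite !inE => /andP[-> /pS].
Qed.

(** The dual, for properties that pass to parents, such as meeting a ball. *)
Lemma geq_card_realization (p : forall n, pred (cube d M n)) n m : (n <= m)%N ->
  (forall k Q, p k.+1 Q -> p k (parent Q)) ->
  (#|[set Q in E m | p m Q]%SET| * nb_cubes N n <=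
   #|[set Q in E n | p n Q]%SET| * nb_cubes N m)%N.
Proof.
move=> + pS; elim: m => [|m IHm]; first by rewrite leqn0 => /eqP->.
rewrite leq_eqVlt => /orP[/eqP->//|/IHm {}IHm].
rewrite nb_cubesS mulnA (leq_trans _ (leq_mul IHm (leqnn _)))//.
rewrite mulnAC leq_mul// mulnC -card_parent subset_leq_card//.
by apply/fintype.subsetP => Q; rewrite !inE => /andP[-> /pS].
Qed.

End realizations.

Section near_cubes.
Variables (d : nat) (M : nat -> nat).

Definition near_cubes n (i : nat) (Q Q' : cube d M n) : bool :=
  [forall l, (Q l <= Q' l + i) && (Q' l <= Q l + i)]%N.

(** The shifted offsets Q'_l + i - Q_l lie in [0, 2i] and determine Q'. *)
Lemma card_near_cubes n i (Q : cube d M n) :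
  (#|[set Q' | near_cubes i Q Q']%SET| <= (i.*2.+1) ^ d)%N.
Proof.
pose f (Q' : cube d M n) : {ffun 'I_d -> 'I_(i.*2.+1)} :=
  [ffun l => inord (Q' l + i - Q l)%N].
have fE Q' l : near_cubes i Q Q' -> f Q' l = (Q' l + i - Q l)%N :> nat.
  move=> /forallP/(_ l)/andP[h1 h2]; rewrite ffunE inordK// ltnS.
  by rewrite leq_subLR -addnn addnA leq_add2r.
have finj : {in [set Q' | near_cubes i Q Q']%SET &, injective f}.
  move=> Q1 Q2; rewrite !inE => n1 n2 e; apply/ffunP => l; apply: val_inj => /=.
  have := congr1 (fun g : {ffun 'I_d -> 'I_(i.*2.+1)} => g l : nat) e.
  rewrite !fE// => /eqP; move: n1 n2 => /forallP/(_ l)/andP[h1 _] /forallP/(_ l)/andP[h2 _].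
  by rewrite -(eqn_add2r (Q l)) !subnK// eqn_add2r => /eqP.
rewrite -(card_in_imset finj) (leq_trans (max_card _))//.
by rewrite card_ffun !card_ord.
Qed.

End near_cubes.

(** * Borel sets and Lebesgue measure *)

Section borel.
Variables (R : realType) (d : nat).

Lemma open_measurable_Rn (U : set 'rV[R]_d) :
  open U -> measurable (U : set (Rn R d)).
Proof. by move=> oU; exact: sub_sigma_algebra. Qed.

Lemma continuous_measurable_Rn (f : 'rV[R]_d -> R) :
  continuous f -> measurable_fun [set: Rn R d] (f : Rn R d -> R).
Proof.
move=> /continuousP cf.
apply: (measurability (@RGenOpens.G R)); first exact: RGenOpens.measurableE.
move=> _ [_ [a [b ->]] <-]; rewrite setTI.
apply: open_measurable_Rn; apply: cf; exact: interval_open.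
Qed.

Lemma measurable_coord (l : 'I_d) :
  measurable_fun [set: Rn R d] (fun x : Rn R d => x ord0 l : R).
Proof. by apply: continuous_measurable_Rn; exact: coord_continuous. Qed.

Definition box (I : 'I_d -> set R) : set (Rn R d) :=
  [set x | forall l, I l (x ord0 l)].

Lemma measurable_box I : (forall l, measurable (I l)) -> measurable (box I).
Proof.
move=> mI; rewrite (_ : box I = \bigcap_(l in [set: 'I_d])
    ((fun x : Rn R d => x ord0 l : R) @^-1` I l)); last first.
  by apply/seteqP; split=> x /= h l; [move=> _; exact: h|exact: h].
apply: fin_bigcap_measurable => // l _; rewrite -[X in measurable X]setTI.
exact: measurable_coord.
Qed.

End borel.

Section boxes_generate.
Variables (R : realType) (d : nat).

Definition open_box (q : 'rV[R]_d) (e : R) : set (Rn R d) :=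
  box (fun l => [set t | `|q ord0 l - t| < e]).

(** The union runs over a countable index set, so measurability of a map into [Rn R d] reduces to
    that of its coordinates. *)
Lemma open_bigcup_rat_box (U : set 'rV[R]_d) : open U ->
  U = \bigcup_(i in [set i : 'rV[rat]_d * nat |
         open_box (map_mx ratr i.1) i.2.+1%:R^-1 `<=` U])
        open_box (map_mx ratr i.1) i.2.+1%:R^-1.
Proof.
move=> oU; apply/seteqP; split=> [x Ux|x [i /= iU xi]]; last exact: iU.
have /nbhs_ballP[e /= e0 xeU] : nbhs x U by exact: open_nbhs_nbhs.
(* A rational centre within 1/(k+1) < e/2 of x gives a box that contains x and stays within e of
   x. *)
have e2 : 0 < e / 2 by rewrite divr_gt0.
have [k _ /(_ k (leqnn k))/= ke] := near_infty_natSinv_lt (PosNum e2).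
have /choice[q qP] : forall l : 'I_d, exists q : rat,
    `|ratr q - x ord0 l| < k.+1%:R^-1.
  move=> l; have k0 : 0 < k.+1%:R^-1 :> R by rewrite invr_gt0.
  have [|q] := @rat_in_itvoo R (x ord0 l - k.+1%:R^-1) (x ord0 l + k.+1%:R^-1).
    by rewrite ltrD2l gt0_cp.
  by rewrite in_itv/= => qx; exists q; rewrite ltr_distl.
exists (\row_l q l, k) => /=; last by move=> l /=; rewrite !mxE.
move=> y yq; apply: xeU; split=> // i l; rewrite ord1.
have := yq l; rewrite /ball/= !mxE => h.
rewrite (le_lt_trans (ler_distD (ratr (q l)) _ _))//.
have := qP l; rewrite distrC => h2.
by rewrite (splitr e) ltrD// (lt_trans _ ke).
Qed.

Lemma measurable_fun_Rn d' (T : measurableType d') (f : T -> Rn R d) :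
  (forall l, measurable_fun [set: T] (fun t => f t ord0 l : R)) ->
  measurable_fun [set: T] f.
Proof.
move=> mf; apply: (@measurability _ _ T (Rn R d) setT f (@open 'rV[R]_d)) => //.
move=> _ [U oU <-]; rewrite setTI (open_bigcup_rat_box oU) preimage_bigcup.
rewrite bigcup_mkcond; apply: countable_bigcupT_measurable => // -[q k].
case: ifPn => // _.
have -> : f @^-1` open_box (map_mx ratr (q, k).1) (q, k).2.+1%:R^-1 =
    \bigcap_(l in [set: 'I_d]) ((fun t => f t ord0 l : R) @^-1`
      [set t | `|(map_mx ratr q : 'rV[R]_d) ord0 l - t| < k.+1%:R^-1]).
  by apply/seteqP; split=> t /= h l; [move=> _; exact: h|exact: h].
apply: fin_bigcap_measurable => // l _; rewrite -[X in measurable X]setTI.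
apply: mf => //; exact: measurable_ball.
Qed.

End boxes_generate.

Section measure_packing.
Context d d' (T : measurableType d) (T' : measurableType d') (R : realType).

Lemma pushforward_measure (m : {measure set T -> \bar R}) (f : T -> T') :
  measurable_fun [set: T] f ->
  exists k : {measure set T' -> \bar R}, forall A, k A = pushforward m f A.
Proof. by move=> mf; unshelve eexists (pushforward m f). Qed.

Section pack.
Variables (m : {measure set T -> \bar R}) (sf : sigma_finite [set: T] m).
Let k : set T -> \bar R := m.
HB.instance Definition _ := Measure.on k.
HB.instance Definition _ := @Measure_isSigmaFinite.Build _ _ _ k sf.

(** Product measures require the bundled sigma-finite structure; this supplies it for a measure with
    a proof of sigma-finiteness. *)
Lemma sigma_finite_pack :
  exists k : {sigma_finite_measure set T -> \bar R}, forall A, k A = m A.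
Proof. by exists k. Qed.
End pack.

End measure_packing.

Section lebesgue.
Variable R : realType.

Lemma row_mx_ord0 d (t : R) (x : Rn R d) :
  (row_mx t%:M x : Rn R d.+1) ord0 ord0 = t.
Proof.
have e : @ord0 d = lshift d (@ord0 0) :> 'I_(1 + d) by exact: val_inj.
by rewrite [X in fun_of_matrix _ _ X]e (@row_mxEl _ 1 1 d) mxE.
Qed.

Lemma row_mx_lift d (t : R) (x : Rn R d) l :
  (row_mx t%:M x : Rn R d.+1) ord0 (lift ord0 l) = x ord0 l.
Proof.
have e : lift ord0 l = rshift 1 l :> 'I_(1 + d) by exact: val_inj.
by rewrite [X in fun_of_matrix _ _ X]e (@row_mxEr _ 1 1 d).
Qed.

Lemma measurable_row_mx d :
  measurable_fun [set: R * Rn R d]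
    (fun p : R * Rn R d => row_mx p.1%:M p.2 : Rn R d.+1).
Proof.
apply: measurable_fun_Rn => l; case: (unliftP ord0 l) => [j|] ->.
  under eq_fun do rewrite row_mx_lift.
  by apply: (@measurableT_comp _ _ _ _ _ _ (fun x : Rn R d => x ord0 j : R));
    [exact: measurable_coord|exact: measurable_snd].
by under eq_fun do rewrite row_mx_ord0; exact: measurable_fst.
Qed.

Lemma preimage_row_mx_box d (I : 'I_d.+1 -> set R) :
  (fun p : R * Rn R d => row_mx p.1%:M p.2 : Rn R d.+1) @^-1` box I =
  I ord0 `*` box (fun l : 'I_d => I (lift ord0 l)).
Proof.
apply/seteqP; split=> p /=.
  move=> h; split=> [|l].
    by rewrite -(row_mx_ord0 p.1 p.2); exact: h.
  by rewrite -(row_mx_lift p.1 p.2); exact: h.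
move=> [h0 hS] l; case: (unliftP ord0 l) => [j|] ->.
  by rewrite row_mx_lift; exact: hS.
by rewrite row_mx_ord0.
Qed.

Lemma lebesgue_measure_symitv (k : nat) :
  @lebesgue_measure R `]- k%:R, k%:R[ = (k%:R *+ 2)%:E.
Proof.
rewrite lebesgue_measure_itv/= lte_fin; case: ifPn => [_|].
  by rewrite -EFinD opprK mulr2n.
rewrite -leNgt => k0; have : k%:R <= 0 :> R by rewrite (le_trans k0)// lerNl oppr0.
by rewrite lern0 => /eqP ->; rewrite mul0rn.
Qed.

(* The recursion defining [lebesgue_Rn] only yields a set function. *)
Lemma lebesgue_Rn_measure d :
  exists m : {sigma_finite_measure set (Rn R d) -> \bar R},
    (forall A, m A = @lebesgue_Rn R d A) /\
    forall (I : 'I_d -> set R) (v : 'I_d -> R), (forall l, measurable (I l)) ->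
      (forall l, @lebesgue_measure R (I l) = (v l)%:E) ->
      @lebesgue_Rn R d (box I) = (\prod_l v l)%:E.
Proof.
elim: d => [|d [m [mE mbox]]].
  exists (dirac (0 : Rn R 0)); split=> // I v _ _.
  by rewrite /= diracE big_ord0 mem_set// => -[].
have lE : @lebesgue_Rn R d = m by apply/funext => A; rewrite mE.
have [k kE] := pushforward_measure (@lebesgue_measure R \x m)%E
  (@measurable_row_mx d).
have {}kE A : k A = @lebesgue_Rn R d.+1 A by rewrite kE/= lE.
have kbox (I : 'I_d.+1 -> set R) (v : 'I_d.+1 -> R) :
    (forall l, measurable (I l)) ->
    (forall l, @lebesgue_measure R (I l) = (v l)%:E) ->
    k (box I) = (\prod_l v l)%:E.
  move=> mI vI; rewrite kE /= /pushforward preimage_row_mx_box lE.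
  rewrite product_measure1E; [|exact: mI|exact: measurable_box].
  have e := mbox (fun l => I (lift ord0 l)) (fun l => v (lift ord0 l))
    (fun l => mI _) (fun l => vI _).
  by rewrite mE [X in (_ * X)%E]e [X in (X * _)%E]vI big_ord_recl EFinM.
have [K KE] : exists K : {sigma_finite_measure set (Rn R d.+1) -> \bar R},
    forall A, K A = k A.
  apply: sigma_finite_pack.
  exists (fun j : nat => box (fun _ : 'I_d.+1 => `]- j%:R, j%:R[%classic : set R)).
    apply/seteqP; split=> // x _.
    pose s : R := \sum_l `|x ord0 l|.
    exists (Num.bound s) => // l /=.
    rewrite in_itv/= -ltr_norml (le_lt_trans _ (archi_boundP _))//.
      by rewrite /s (bigD1 l)//= lerDl sumr_ge0.
    by rewrite sumr_ge0.
  move=> j; split; first exact: measurable_box.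
  rewrite (kbox _ (fun=> j%:R *+ 2)) ?ltry// => l.
  exact: lebesgue_measure_symitv.
exists K; split=> [A|I v mI vI]; first by rewrite KE.
by rewrite -kE; exact: kbox.
Qed.

End lebesgue.

(** * Cubes and the measures mu_n *)

Section set_function_integral.
Import HBNNSimple.

(** The level sets of simple functions are measurable, so an integral sees a set function only on
    measurable sets. This matters because [mu_n] is a bare set function. *)
Lemma eq_set_function_integral d (T : measurableType d) (R : realType)
    (mu nu : set T -> \bar R) (D : set T) (f : T -> \bar R) :
  (forall A, measurable A -> mu A = nu A) ->
  (\int[mu]_(x in D) f x = \int[nu]_(x in D) f x)%E.
Proof.
move=> e; have es (h : {nnsfun T >-> R}) : sintegral mu h = sintegral nu h.
  by apply: eq_fsbigr => x _; congr (_ * _)%E; apply: e; exact: measurable_sfunP.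
rewrite /integral; congr (_ - _)%E; congr ereal_sup;
  by apply/seteqP; split=> _ [h hf <-]; exists h => //; rewrite es.
Qed.

End set_function_integral.

Section cubes.
Variables (R : realType) (d : nat) (M N : nat -> nat).
Hypothesis hM : forall k, (1 <= k)%N -> (2 <= M k)%N.

Local Notation cset := (@cube_set R d M _).

Lemma res_gt0 n : (0 < res M n)%N.
Proof.
by elim: n => [|n IHn]; rewrite ?res0// resS muln_gt0 IHn (leq_trans _ (hM _)).
Qed.

Lemma side_gt0 n : 0 < side R M n.
Proof. by rewrite invr_gt0 ltr0n res_gt0. Qed.

Lemma cube_setE n (Q : cube d M n) : cset Q = box (fun l =>
  `[(Q l)%:R * side R M n, (Q l).+1%:R * side R M n]%classic).
Proof. by apply/seteqP; split=> x h l; have := h l; rewrite /= in_itv. Qed.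

Lemma measurable_cube_set n (Q : cube d M n) : measurable (cset Q).
Proof. by rewrite cube_setE; exact: measurable_box. Qed.

(** Closed cubes of D_n share faces; the half-open ones are disjoint and have the same volume, so
    their volumes add up. *)
Definition half_open_cube n (Q : cube d M n) : set (Rn R d) :=
  box (fun l => `[(Q l)%:R * side R M n, (Q l).+1%:R * side R M n[%classic).

Lemma measurable_half_open_cube n (Q : cube d M n) :
  measurable (half_open_cube Q).
Proof. exact: measurable_box. Qed.

Lemma sub_half_open_cube n (Q : cube d M n) :
  half_open_cube Q `<=` cset Q.
Proof.
by move=> x h l; have := h l; rewrite /= in_itv/= => /andP[-> /ltW].
Qed.

Lemma lebesgue_cube_set n (Q : cube d M n) :
  @lebesgue_Rn R d (cset Q) = (side R M n ^+ d)%:E.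
Proof.
have [m [_ mbox]] := lebesgue_Rn_measure R d.
rewrite cube_setE (mbox _ (fun=> side R M n)) ?prodr_const ?card_ord// => l.
rewrite lebesgue_measure_itv/= lte_fin ltr_pM2r ?side_gt0// ltr_nat ltnSn.
by rewrite -EFinB -mulrBl -natrB// subSnn mul1r.
Qed.

Lemma lebesgue_half_open_cube n (Q : cube d M n) :
  @lebesgue_Rn R d (half_open_cube Q) = (side R M n ^+ d)%:E.
Proof.
have [m [_ mbox]] := lebesgue_Rn_measure R d.
rewrite (mbox _ (fun=> side R M n)) ?prodr_const ?card_ord// => l.
rewrite lebesgue_measure_itv/= lte_fin ltr_pM2r ?side_gt0// ltr_nat ltnSn.
by rewrite -EFinB -mulrBl -natrB// subSnn mul1r.
Qed.

Lemma half_open_cube_inj n (Q Q' : cube d M n) x :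
  half_open_cube Q x -> half_open_cube Q' x -> Q = Q'.
Proof.
move=> Qx Q'x; apply/ffunP => l; apply: val_inj => /=.
have /= := Qx l; rewrite in_itv/= => /andP[a1 b1].
have /= := Q'x l; rewrite in_itv/= => /andP[a2 b2].
have := le_lt_trans a1 b2; have := le_lt_trans a2 b1.
rewrite !ltr_pM2r ?side_gt0// !ltr_nat !ltnS => u v.
by apply/eqP; rewrite eqn_leq u v.
Qed.

Lemma cube_set_parent n (Q : cube d M n.+1) :
  cset Q `<=` cset (parent Q).
Proof.
move=> x h l; have /andP[h1 h2] := h l; rewrite ffunE/=.
have M0 : (0 < M n.+1)%N by rewrite (leq_trans _ (hM _)).
have sE : side R M n = (M n.+1)%:R * side R M n.+1.
  rewrite /side resS natrM invfM mulrCA mulfV ?mulr1// pnatr_eq0 -lt0n//.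
rewrite sE !mulrA -!natrM; apply/andP; split.
  rewrite (le_trans _ h1)// ler_pM2r ?side_gt0// ler_nat; exact: leq_divM.
rewrite (le_trans h2)// ler_pM2r ?side_gt0// ler_nat; exact: ltn_ceil.
Qed.

End cubes.

Section finset_measure.
Context dd (T : measurableType dd) (R : realType) (m : {measure set T -> \bar R}).
Variables (I : finType) (S : {set I}) (F : I -> set T).
Hypothesis mF : forall i, measurable (F i).

Lemma fsbig_finset (f : I -> \bar R) :
  (\sum_(i \in [set` S]) f i = \sum_(i in S) f i)%E.
Proof.
have -> : [set` S] = [set` enum S] by apply/seteqP; split=> i /=; rewrite mem_enum.
by rewrite -[RHS]big_enum [RHS]fsbig_seq ?enum_uniq.
Qed.

Lemma measure_finset_bigcup : trivIset [set` S] F ->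
  (m (\bigcup_(i in [set` S]) F i) = \sum_(i in S) m (F i))%E.
Proof. by move=> tF; rewrite measure_fin_bigcup ?fsbig_finset. Qed.

Lemma measurable_finset_bigcup : measurable (\bigcup_(i in [set` S]) F i).
Proof. exact: fin_bigcup_measurable. Qed.

Lemma le_measure_finset_bigcup A : measurable A ->
  A `<=` \bigcup_(i in [set` S]) F i -> (m A <= \sum_(i in S) m (F i))%E.
Proof. by move=> mA AF; rewrite -fsbig_finset; exact: content_sub_fsum. Qed.

End finset_measure.

Section mu_n_bounds.
Variables (R : realType) (d : nat) (M N : nat -> nat).
Hypothesis hM : forall k, (1 <= k)%N -> (2 <= M k)%N.
Hypothesis hN : forall k, (1 <= k)%N -> (1 <= N k <= M k ^ d)%N.
Variable E : Omega hN.

Local Notation cset := (@cube_set R d M _).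

Lemma nb_cubes_gt0 n : (0 < nb_cubes N n)%N.
Proof.
elim: n => [|n IHn]; rewrite ?nb_cubes0// nb_cubesS muln_gt0 IHn.
by have /andP[] := hN (ltn0Sn n).
Qed.

Lemma density_gt0 n : 0 < density R d M N n.
Proof. by rewrite mulr_gt0 ?ltr0n ?nb_cubes_gt0// exprn_gt0// side_gt0. Qed.

Lemma measurable_level_set n : measurable (@level_set R d M N hN E n).
Proof.
by apply: measurable_finset_bigcup => Q; exact: measurable_cube_set.
Qed.

Lemma mu_nE n A : measurable A ->
  mu_n E n A =
  ((density R d M N n)^-1%:E * @lebesgue_Rn R d (A `&` level_set E n))%E.
Proof.
move=> mA; have [m [mE _]] := lebesgue_Rn_measure R d.
have lE : @lebesgue_Rn R d = m by apply/funext => B; rewrite mE.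
have mAl : measurable (A `&` @level_set R d M N hN E n).
  by apply: measurableI => //; exact: measurable_level_set.
rewrite /mu_n lE; under eq_integral do rewrite EFinM.
rewrite ge0_integralZr//=.
- by rewrite integral_indic// setIT muleC.
- by apply/measurable_EFinP; exact: measurable_indic.
- by rewrite lee_fin invr_ge0 ltW// density_gt0.
Qed.

(** Dividing by the density cancels r_n^d, so the total volume of cubes turns into a proportion of
    the P_n chosen ones. *)
Lemma density_count n (S : {set cube d M n}) :
  ((density R d M N n)^-1%:E * (\sum_(Q in S) (side R M n ^+ d)%:E) =
   (#|S|%:R / (nb_cubes N n)%:R)%:E)%E.
Proof.
rewrite sumEFin sumr_const -EFinM -[in LHS]mulr_natl mulrCA; congr ((_ * _)%:E).
by rewrite /density invfM -mulrA mulVf ?mulr1// expf_neq0// gt_eqF// side_gt0.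
Qed.

Lemma mu_n_ge n A : measurable A ->
  ((#|[set Q in sval E n | `[< cset Q `<=` A >]]%SET|%:R /
    (nb_cubes N n)%:R)%:E <= mu_n E n A)%E.
Proof.
move=> mA; have [m [mE _]] := lebesgue_Rn_measure R d.
set S := [set Q in _ | _]%SET.
rewrite mu_nE// -mE -density_count lee_pmul2l//; last first.
  by rewrite lte_fin invr_gt0 density_gt0.
have tS : trivIset [set` S] (@half_open_cube R d M n).
  by move=> Q Q' _ _ [x [Qx Q'x]]; exact: half_open_cube_inj Qx Q'x.
have mh := @measurable_half_open_cube R d M n.
under eq_bigr => Q _ do rewrite -(lebesgue_half_open_cube _ hM Q) -mE.
rewrite -measure_finset_bigcup//; apply: le_measure; rewrite ?inE.
- exact: measurable_finset_bigcup.
- by apply: measurableI => //; exact: measurable_level_set.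
move=> x [Q /=]; rewrite inE => /andP[QE /asboolP QA] Qx.
by split; [exact/QA/sub_half_open_cube|exists Q => //; exact: sub_half_open_cube].
Qed.

(** Here subadditivity suffices, so the overlaps of the closed cubes do no harm. *)
Lemma mu_n_le n A : measurable A ->
  (mu_n E n A <= (#|[set Q in sval E n | `[< cset Q `&` A !=set0 >]]%SET|%:R /
    (nb_cubes N n)%:R)%:E)%E.
Proof.
move=> mA; have [m [mE _]] := lebesgue_Rn_measure R d.
set S := [set Q in _ | _]%SET.
rewrite mu_nE// -mE -density_count lee_pmul2l//; last first.
  by rewrite lte_fin invr_gt0 density_gt0.
have mh := @measurable_cube_set R d M n.
under eq_bigr => Q _ do rewrite -(lebesgue_cube_set _ hM Q) -mE.
apply: le_measure_finset_bigcup => //.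
  by apply: measurableI => //; exact: measurable_level_set.
move=> x [Ax [Q /= QE Qx]]; exists Q => //=; rewrite inE QE/=.
by apply/asboolP; exists x.
Qed.

(** On measurable sets [mu_n] is Lebesgue measure restricted to the level set and rescaled. *)
Lemma mu_n_measure n : exists m : {measure set (Rn R d) -> \bar R},
  forall A, measurable A -> mu_n E n A = m A.
Proof.
have [m [mE _]] := lebesgue_Rn_measure R d.
have d0 : 0 <= (density R d M N n)^-1 by rewrite invr_ge0 ltW// density_gt0.
exists (mscale (NngNum d0) (mrestr m (measurable_level_set n))) => A mA.
by rewrite mu_nE// -mE.
Qed.

End mu_n_bounds.

(** * Passing to the weak limit *)

Section sup_ball.
Variables (R : realType) (d : nat).

(** The norm on row vectors is the sup norm, so these balls are cubes and fit the counting of cubes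
    of D_n. *)
Definition sup_ball (c : Rn R d) (a : R) : set (Rn R d) :=
  [set y | `|(y : 'rV[R]_d) - c| <= a].

Lemma sup_ballP c a y : 0 <= a ->
  sup_ball c a y <-> forall l, `|y ord0 l - c ord0 l| <= a.
Proof.
move=> a0; rewrite /sup_ball /= [`|_|]mx_normrE; split=> [h l|h].
  have := le_trans (le_bigmax _ (fun i => `|(y - c) i.1 i.2|) (ord0, l)) h.
  by rewrite !mxE.
by apply: bigmax_le => // -[i l] _ /=; rewrite (ord1 i) !mxE.
Qed.

Lemma continuous_dist (c : 'rV[R]_d) : continuous (fun y : 'rV[R]_d => `|y - c|).
Proof.
move=> y; have F : Filter (nbhs y) := @nbhs_filter 'rV[R]_d y.
have cc := @cst_continuous 'rV[R]_d 'rV[R]_d c y.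
exact: (@cvg_norm R 'rV[R]_d 'rV[R]_d (nbhs y) F _ _ (cvgB cvg_id cc)).
Qed.

Lemma measurable_sup_ball c a : measurable (sup_ball c a).
Proof.
rewrite (_ : sup_ball c a = [set: Rn R d] `&`
    (fun y : 'rV[R]_d => `|y - c|) @^-1` [set` `]-oo, a]]).
  by apply: (continuous_measurable_Rn (@continuous_dist c)).
by rewrite setTI; apply/seteqP; split=> y; rewrite /sup_ball/= in_itv.
Qed.

(** For a < b, a continuous cut-off between the indicators of [sup_ball c a] and [sup_ball c b],
    linear in the distance to c in between. *)
Definition bump (c : 'rV[R]_d) (a b : R) (y : 'rV[R]_d) : R :=
  Num.max 0 (Num.min 1 ((b - `|y - c|) / (b - a))).

Lemma continuous_bump c a b : continuous (bump c a b).
Proof.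
move=> y; have F : Filter (nbhs y) := @nbhs_filter 'rV[R]_d y.
have cc (k : R) : {for y, continuous (fun=> k : R)}.
  exact: (@cst_continuous 'rV[R]_d R k y).
apply: (@continuous_max R 'rV[R]_d (fun=> 0)); first exact: cc.
apply: (@continuous_min R 'rV[R]_d (fun=> 1)); first exact: cc.
exact: (cvgMr_tmp (cvgB (cc b) (@continuous_dist c y))).
Qed.

Lemma measurable_bump c a b :
  measurable_fun [set: Rn R d] (fun x => (bump c a b x)%:E).
Proof.
apply/measurable_EFinP.
exact: (@continuous_measurable_Rn R d _ (@continuous_bump c a b)).
Qed.

Lemma bump_ge0 c a b y : 0 <= bump c a b y.
Proof. by rewrite le_max lexx. Qed.

Lemma bump_le1 c a b y : bump c a b y <= 1.
Proof. by rewrite ge_max ler01 ge_min lexx. Qed.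

Lemma bump_ge_indic c a b y : a < b -> \1_(sup_ball c a) y <= bump c a b y.
Proof.
move=> ab; rewrite indicE; case: (boolP (y \in _)) => [|_]; last exact: bump_ge0.
rewrite inE /sup_ball/= => ya; rewrite le_max le_min lexx/=.
by rewrite ler_pdivlMr ?subr_gt0// mul1r lerB ?orbT.
Qed.

Lemma bump_le_indic c a b y : a < b -> bump c a b y <= \1_(sup_ball c b) y.
Proof.
move=> ab; rewrite indicE; case: (boolP (y \in _)) => [_|]; first exact: bump_le1.
rewrite notin_setE /sup_ball/= => /negP; rewrite -ltNge => yb.
rewrite ge_max lexx/= ge_min; apply/orP; right.
by rewrite ler_pdivrMr ?subr_gt0// mul0r subr_le0 ltW.
Qed.

End sup_ball.

Section natural_measure_bounds.
Variables (R : realType) (d : nat) (M N : nat -> nat).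
Hypothesis hM : forall k, (1 <= k)%N -> (2 <= M k)%N.
Hypothesis hN : forall k, (1 <= k)%N -> (1 <= N k <= M k ^ d)%N.
Variables (E : Omega hN) (mu : {measure set (Rn R d) -> \bar R}).
Hypothesis hmu : natural_measure E mu.

Local Notation cset := (@cube_set R d M _).

Lemma bump_integral_cvg c a b :
  (\int[mu_n E n]_(x in [set: Rn R d]) (bump c a b x)%:E)%E @[n --> \oo] -->
    (\int[mu]_(x in [set: Rn R d]) (bump c a b x)%:E)%E.
Proof.
apply: hmu; first exact: continuous_bump.
by exists 1 => x; rewrite ger0_norm ?bump_ge0// bump_le1.
Qed.

Lemma bump_integral_ge (nu : {measure set (Rn R d) -> \bar R}) c a b : a < b ->
  (nu (sup_ball c a) <= \int[nu]_(x in [set: Rn R d]) (bump c a b x)%:E)%E.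
Proof.
move=> ab; rewrite -[sup_ball _ _]setIT -integral_indic//; last exact: measurable_sup_ball.
apply: ge0_le_integral => //.
- by apply/measurable_EFinP; apply: measurable_indic; exact: measurable_sup_ball.
- exact: measurable_bump.
- by move=> x _; rewrite lee_fin bump_ge_indic.
Qed.

Lemma bump_integral_le (nu : {measure set (Rn R d) -> \bar R}) c a b : a < b ->
  (\int[nu]_(x in [set: Rn R d]) (bump c a b x)%:E <= nu (sup_ball c b))%E.
Proof.
move=> ab; rewrite -[sup_ball _ _]setIT -integral_indic//; last exact: measurable_sup_ball.
apply: ge0_le_integral => //.
- by move=> x _; rewrite lee_fin bump_ge0.
- exact: measurable_bump.
- by apply/measurable_EFinP; apply: measurable_indic; exact: measurable_sup_ball.
- by move=> x _; rewrite lee_fin bump_le_indic.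
Qed.

(** The integrals of the cut-off against [mu_n E m] converge. For m >= n each is at most the
    proportion of cubes of E_m that meet the larger ball, hence at most that proportion at level n,
    since the parent of a cube meeting the ball meets it too. *)
Lemma natural_measure_le n c a b : a < b ->
  (mu (sup_ball c a) <=
   (#|[set Q in sval E n | `[< cset Q `&` sup_ball c b !=set0 >]]%SET|%:R /
    (nb_cubes N n)%:R)%:E)%E.
Proof.
move=> ab; apply: le_trans (bump_integral_ge mu c ab) _.
rewrite -(cvg_lim _ (@bump_integral_cvg c a b))//; apply: lime_le.
  by apply/cvg_ex; eexists; exact: bump_integral_cvg.
exists n => // m /= nm; have [nu nuE] := mu_n_measure R hM E m.
rewrite (eq_set_function_integral _ _ nuE) (le_trans (bump_integral_le nu c ab))//.
rewrite -nuE; last exact: measurable_sup_ball.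
apply: le_trans (mu_n_le hM E m (measurable_sup_ball c b)) _.
rewrite lee_fin ler_pdivrMr ?ltr0n ?(nb_cubes_gt0 hN)// mulrAC.
rewrite ler_pdivlMr ?ltr0n ?(nb_cubes_gt0 hN)// -!natrM ler_nat.
apply: (geq_card_realization (svalP E)
  (p := fun k Q => `[< cset Q `&` sup_ball c b !=set0 >])) => //.
move=> k Q /asboolP[x [Qx bx]]; apply/asboolP; exists x; split=> //.
exact: cube_set_parent.
Qed.

(** The same argument with inclusion in the smaller ball, which passes from a cube to its
    children. *)
Lemma natural_measure_ge n c a b : a < b ->
  ((#|[set Q in sval E n | `[< cset Q `<=` sup_ball c a >]]%SET|%:R /
    (nb_cubes N n)%:R)%:E <= mu (sup_ball c b))%E.
Proof.
move=> ab; apply: le_trans _ (bump_integral_le mu c ab).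
rewrite -(cvg_lim _ (@bump_integral_cvg c a b))//; apply: lime_ge.
  by apply/cvg_ex; eexists; exact: bump_integral_cvg.
exists n => // m /= nm; have [nu nuE] := mu_n_measure R hM E m.
rewrite (eq_set_function_integral _ _ nuE) (le_trans _ (bump_integral_ge nu c ab))//.
rewrite -nuE; last exact: measurable_sup_ball.
apply: le_trans _ (mu_n_ge hM E m (measurable_sup_ball c a)).
rewrite lee_fin ler_pdivrMr ?ltr0n ?(nb_cubes_gt0 hN)// mulrAC.
rewrite ler_pdivlMr ?ltr0n ?(nb_cubes_gt0 hN)// -!natrM ler_nat.
apply: (leq_card_realization (svalP E)
  (p := fun k Q => `[< cset Q `<=` sup_ball c a >])) => //.
move=> k Q /asboolP Qa; apply/asboolP; apply: subset_trans Qa.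
exact: cube_set_parent.
Qed.

End natural_measure_bounds.

(** * Euclidean balls and sup-norm balls *)

Section balls.
Variables (R : realType) (d : nat).

Lemma measurable_cball (x : Rn R d) r : measurable (cball x r).
Proof.
rewrite (_ : cball x r = [set: Rn R d] `&`
    (fun y : Rn R d => Num.sqrt (\sum_(i < d) (y ord0 i - x ord0 i) ^+ 2)) @^-1`
      [set` `]-oo, r]]).
  suff : measurable_fun [set: Rn R d] (fun y : Rn R d =>
    Num.sqrt (\sum_(i < d) (y ord0 i - x ord0 i) ^+ 2)) by apply.
  apply: (measurableT_comp (continuous_measurable_fun (@sqrt_continuous R))).
  apply: measurable_sum => i; apply: measurable_funX.
  by apply: measurable_funB => //; exact: measurable_coord.
by rewrite setTI; apply/seteqP; split=> y; rewrite /cball/= in_itv.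
Qed.

Lemma cball_sub_sup_ball (x : Rn R d) r : 0 <= r -> cball x r `<=` sup_ball x r.
Proof.
move=> r0 y; rewrite /cball /= => h; apply/sup_ballP => // l.
rewrite -sqrtr_sqr (le_trans _ h)// ler_wsqrtr// (bigD1 l)//= lerDl.
by rewrite sumr_ge0 => // i _; rewrite sqr_ge0.
Qed.

(** The sharp factor is sqrt d; the cruder d costs only a bounded shift of the logarithmic scale. *)
Lemma sup_ball_sub_cball (x : Rn R d) r : 0 <= r ->
  sup_ball x r `<=` cball x (d%:R * r).
Proof.
move=> r0 y /(sup_ballP _ _ r0) h; rewrite /cball /=.
have d0 : 0 <= d%:R * r by rewrite mulr_ge0.
rewrite -(ger0_norm d0) -sqrtr_sqr ler_wsqrtr// exprMn.
apply: (@le_trans _ _ (\sum_(i < d) r ^+ 2)).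
  by apply: ler_sum => i _; rewrite -real_normK ?num_real// ler_pXn2r ?nnegrE.
rewrite sumr_const card_ord -[leLHS]mulr_natl ler_wpM2r ?sqr_ge0//.
by rewrite -natrX ler_nat; case: (d) => // k; rewrite expnS leq_pmulr// expn_gt0.
Qed.

Lemma sub_sup_ball (x : Rn R d) r s : r <= s -> sup_ball x r `<=` sup_ball x s.
Proof. by move=> rs y; rewrite /sup_ball /= => /le_trans; apply. Qed.

Lemma sub_cball (x : Rn R d) r s : r <= s -> cball x r `<=` cball x s.
Proof. by move=> rs y; rewrite /cball /= => /le_trans; apply. Qed.

End balls.

Section ball_bounds.
Variables (R : realType) (d : nat) (M N : nat -> nat).
Hypothesis hM : forall k, (1 <= k)%N -> (2 <= M k)%N.
Hypothesis hN : forall k, (1 <= k)%N -> (1 <= N k <= M k ^ d)%N.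
Variables (E : Omega hN) (mu : {measure set (Rn R d) -> \bar R}).
Hypothesis hmu : natural_measure E mu.

Local Notation cset := (@cube_set R d M _).
Local Notation s := (side R M).

(** The extra unit in [j.+1] comes from the position of the two points inside their cubes. *)
Lemma near_cubes_of_close n j (Q Q' : cube d M n) x y : cset Q x -> cset Q' y ->
  sup_ball x (j%:R * s n) y -> near_cubes j.+1 Q Q'.
Proof.
move=> Qx Q'y xy; have s0 := side_gt0 R hM n.
have /sup_ballP {}xy := xy; have {}xy := xy (mulr_ge0 (ler0n _ _) (ltW s0)).
apply/forallP => l; have /andP[a1 b1] := Qx l; have /andP[a2 b2] := Q'y l.
have := xy l; rewrite ler_norml => /andP[c1 c2]; apply/andP; split.
  rewrite -(ler_nat R) -(ler_pM2r s0) addnS -addSn natrD mulrDl; lra.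
rewrite -(ler_nat R) -(ler_pM2r s0) addnS -addSn natrD mulrDl; lra.
Qed.

Lemma mu_sup_ball_le_near n j (Q : cube d M n) x a :
  cset Q x -> a < j%:R * s n ->
  (mu (sup_ball x a) <=
   (#|[set Q' in sval E n | near_cubes j.+1 Q Q']%SET|%:R /
    (nb_cubes N n)%:R)%:E)%E.
Proof.
move=> Qx aj; apply: le_trans (natural_measure_le hM hmu n x aj) _.
rewrite lee_fin ler_pM2r ?invr_gt0 ?ltr0n ?(nb_cubes_gt0 hN)// ler_nat.
apply: subset_leq_card; apply/fintype.subsetP => Q'; rewrite !inE.
move=> /andP[-> /asboolP[y [Q'y xy]]] /=.
exact: near_cubes_of_close Qx Q'y xy.
Qed.

Lemma cset_sub_sup_ball n (Q : cube d M n) x : cset Q x ->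
  cset Q `<=` sup_ball x (s n).
Proof.
move=> Qx y Qy; apply/sup_ballP => [|l]; first exact/ltW/side_gt0.
have /andP[a1 b1] := Qx l; have /andP[a2 b2] := Qy l.
move: b1 b2; rewrite -!natr1 !mulrDl !mul1r => b1 b2.
rewrite ler_norml; apply/andP; split; lra.
Qed.

(** The whole cube lies within r_n of x; the factor 2 leaves room for the cut-off. *)
Lemma mu_sup_ball_ge n (Q : cube d M n) x : Q \in sval E n -> cset Q x ->
  ((nb_cubes N n)%:R^-1%:E <= mu (sup_ball x (2 * s n)))%E.
Proof.
move=> QE Qx; have s0 := side_gt0 R hM n.
have ab : s n < 2 * s n by rewrite mulr_natl mulr2n ltrDl.
apply: le_trans _ (natural_measure_ge hM hmu n x ab).
rewrite lee_fin -[leLHS]mul1r ler_pM2r ?invr_gt0 ?ltr0n ?(nb_cubes_gt0 hN)//.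
rewrite ler1n card_gt0; apply/set0Pn; exists Q; rewrite inE QE/=.
by apply/asboolP; exact: cset_sub_sup_ball.
Qed.

Lemma mu_sup_ball_le n j (Q : cube d M n) x a :
  cset Q x -> a < j%:R * s n ->
  (mu (sup_ball x a) <= ((j.+1.*2.+1 ^ d)%:R / (nb_cubes N n)%:R)%:E)%E.
Proof.
move=> Qx aj; apply: le_trans (mu_sup_ball_le_near Qx aj) _.
rewrite lee_fin ler_pM2r ?invr_gt0 ?ltr0n ?(nb_cubes_gt0 hN)// ler_nat.
apply: leq_trans _ (card_near_cubes j.+1 Q); apply: subset_leq_card.
by apply/fintype.subsetP => Q'; rewrite !inE => /andP[].
Qed.

(** The cube lies in the ball of radius r_n about its lowest corner. With j = 2 the relevant indices
    differ by at most 3 in each coordinate, which leaves 2 * 3 + 1 = 7 values. *)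
Lemma mu_cube_set_le n (Q : cube d M n) :
  (mu (cset Q) <= ((7 ^ d)%:R / (nb_cubes N n)%:R)%:E)%E.
Proof.
have s0 := side_gt0 R hM n.
pose x : Rn R d := \row_l ((Q l)%:R * s n).
have Qx : cset Q x.
  by move=> l; rewrite mxE lexx/= ler_pM2r// ler_nat.
have ab : s n < 2%:R * s n by rewrite mulr_natl mulr2n ltrDl.
apply: le_trans _ (mu_sup_ball_le Qx ab); apply: le_measure.
- by rewrite inE; exact: measurable_cube_set.
- by rewrite inE; exact: measurable_sup_ball.
- exact: cset_sub_sup_ball.
Qed.

End ball_bounds.

(** * Almost every point, for a fixed realization *)

Lemma borel_cantelli_ae dd (T : measurableType dd) (R : realType)
    (mu : {measure set T -> \bar R}) (B : (set T)^nat) :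
  (forall m, measurable (B m)) -> (\sum_(m <oo) mu (B m) < +oo)%E ->
  {ae mu, forall x, exists m0, forall m, (m0 <= m)%N -> ~ B m x}.
Proof.
move=> mB sB; exists (lim_sup_set B); split.
- apply: bigcapT_measurable => n; apply: bigcup_measurable => k _; exact: mB.
- exact: lim_sup_set_cvg0.
move=> x /= nx n _; apply: contra_notP nx => nx; exists n => m nm Bm.
by apply: nx; exists m.
Qed.

Section weights.
Variable R : realType.

(* The sum of 1 / weight m over n <= m is 1 / (m.+1 * m.+2), which telescopes. *)
Definition weight (m : nat) : R := (m.+1 ^ 2 * m.+2)%:R.

Lemma weight_ge1 m : 1 <= weight m.
Proof. by rewrite ler1n muln_gt0 expn_gt0. Qed.

Lemma weight_gt0 m : 0 < weight m.
Proof. exact: lt_le_trans (weight_ge1 m). Qed.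

Lemma sum_inv_weight k :
  \sum_(0 <= m < k) (m.+1%:R / weight m) = 1 - k.+1%:R^-1 :> R.
Proof.
elim: k => [|k IHk]; first by rewrite big_geq// invr1 subrr.
rewrite big_nat_recr//= IHk /weight natrM natrX.
have k1 : k.+1%:R != 0 :> R by rewrite pnatr_eq0.
have k2 : k.+2%:R != 0 :> R by rewrite pnatr_eq0.
have e : k.+2%:R = k.+1%:R + 1 :> R by rewrite natr1.
rewrite e in k2 *; move: (k.+1%:R) k1 k2 => a k1 k2.
by field; rewrite k1 k2.
Qed.

Lemma nneseries_inv_weight (C : R) : 0 <= C ->
  (\sum_(m <oo) (C * (m.+1%:R / weight m))%:E < +oo)%E.
Proof.
move=> C0; apply: (@le_lt_trans _ _ C%:E); last exact: ltry.
apply: lime_le.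
  by apply: is_cvg_nneseries => m _ _; rewrite lee_fin mulr_ge0// divr_ge0// ltW// weight_gt0.
apply: nearW => k; rewrite sumEFin lee_fin -mulr_sumr sum_inv_weight.
by rewrite ler_piMr// lerBlDr lerDl invr_ge0.
Qed.

End weights.

Section sparse_subcubes.
Variables (R : realType) (d : nat) (M N : nat -> nat).
Hypothesis hM : forall k, (1 <= k)%N -> (2 <= M k)%N.
Hypothesis hN : forall k, (1 <= k)%N -> (1 <= N k <= M k ^ d)%N.
Variables (E : Omega hN) (mu : {measure set (Rn R d) -> \bar R}).

Local Notation cset := (@cube_set R d M _).
Local Notation s := (side R M).

(** The cells of the grid cutting Q into j^d equal cubes. As j is adapted to a dyadic radius, they
    need not belong to any of the families D_m. *)
Definition subcube n (Q : cube d M n) j (c : {ffun 'I_d -> 'I_j}) : set (Rn R d) :=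
  box (fun l => `[(Q l * j + c l)%:R * (s n / j%:R),
                  (Q l * j + c l).+1%:R * (s n / j%:R)]%classic).

Lemma measurable_subcube n (Q : cube d M n) j c : measurable (@subcube n Q j c).
Proof. exact: measurable_box. Qed.

Lemma subcube_cover n (Q : cube d M n) j x : (0 < j)%N -> cset Q x ->
  exists c, @subcube n Q j c x.
Proof.
move=> j0 Qx; have s0 := side_gt0 R hM n.
have sj0 : 0 < s n / j%:R by rewrite divr_gt0// ltr0n.
have /choice[c hc] : forall l : 'I_d, exists c : 'I_j,
    (Q l * j + c)%:R * (s n / j%:R) <= x ord0 l <= (Q l * j + c).+1%:R * (s n / j%:R).
  move=> l; have /andP[a b] := Qx l.
  pose t := x ord0 l / (s n / j%:R) - (Q l * j)%:R.
  have xE : x ord0 l = (t + (Q l * j)%:R) * (s n / j%:R).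
    by rewrite /t subrK divfK// gt_eqF.
  have t0 : 0 <= t.
    rewrite subr_ge0 ler_pdivlMr// natrM -mulrA [X in _ * X]mulrCA divff ?mulr1//.
    by rewrite pnatr_eq0 -lt0n.
  have tj : t <= j%:R.
    rewrite lerBlDr ler_pdivrMr// -natrD -mulSn natrM -mulrA.
    by rewrite [X in _ * X]mulrCA divff ?mulr1// pnatr_eq0 -lt0n.
  (* Capping the index at j - 1 assigns the points of the upper face to the last cell. *)
  have kj : (minn (Num.truncn t) j.-1 < j)%N.
    by rewrite -[X in (_ < X)%N](prednK j0) ltnS geq_minr.
  exists (Ordinal kj); rewrite xE !ler_pM2r//= -addnS !natrD ![t + _]addrC !lerD2l.
  have /andP[tl tu] := truncn_itv t0; apply/andP; split.
    by rewrite (le_trans _ tl)// ler_nat geq_minl.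
  case: (leqP (Num.truncn t) j.-1) => h; first exact: ltW.
  by rewrite prednK.
exists [ffun l => c l] => l /=; rewrite in_itv/= ffunE; exact: hc.
Qed.

Lemma subcube_sub_sup_ball n (Q : cube d M n) j (c : {ffun 'I_d -> 'I_j}) x :
  subcube Q c x -> subcube Q c `<=` sup_ball x (s n / j%:R).
Proof.
move=> Qx y Qy; have s0 := side_gt0 R hM n; apply/sup_ballP => [|l].
  by rewrite divr_ge0// ltW.
have := Qx l; rewrite /= in_itv/= => /andP[a1 b1].
have := Qy l; rewrite /= in_itv/= => /andP[a2 b2].
move: b1 b2; rewrite -!natr1 !mulrDl !mul1r => b1 b2.
rewrite ler_norml; apply/andP; split; lra.
Qed.

(* [B] is the union of the subcubes carrying at most the fraction [theta] of the
   average mass; there are at most [nb_cubes N n * j ^ d] of them. *)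
Lemma sparse_subcubes n j theta : (0 < j)%N -> 0 <= theta ->
  exists B : set (Rn R d), [/\ measurable B, (mu B <= theta%:E)%E &
    forall x, level_set E n x -> ~ B x ->
      ((theta / (nb_cubes N n * j ^ d)%:R)%:E < mu (sup_ball x (s n / j%:R)))%E].
Proof.
move=> j0 theta0; pose u := theta / (nb_cubes N n * j ^ d)%:R.
pose I := (cube d M n * {ffun 'I_d -> 'I_j})%type.
pose S : {set I} := [set p : I | (p.1 \in sval E n) &&
  `[< (mu (subcube p.1 p.2) <= u%:E)%E >]]%SET.
pose F (p : I) := subcube p.1 p.2.
have mF p : measurable (F p) by exact: measurable_subcube.
exists (\bigcup_(p in [set` S]) F p); split.
- exact: measurable_finset_bigcup.
- apply: (@le_trans _ _ (\sum_(p in S) mu (F p))%E).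
    by apply: le_measure_finset_bigcup => //; exact: measurable_finset_bigcup.
  apply: (@le_trans _ _ (\sum_(p in S) u%:E)%E).
    by apply: lee_sum => p; rewrite inE => /andP[_ /asboolP].
  rewrite sumEFin lee_fin sumr_const -[leLHS]mulr_natl /u mulrCA ler_piMr//.
  rewrite ler_pdivrMr ?ltr0n ?muln_gt0 ?(nb_cubes_gt0 hN) ?expn_gt0 ?j0//.
  rewrite mul1r ler_nat -(card_realization (svalP E)).
  apply: (@leq_trans #|finset.setX (sval E n) [set: {ffun 'I_d -> 'I_j}]%SET|).
    by apply: subset_leq_card; apply/fintype.subsetP => p; rewrite !inE => /andP[->].
  by rewrite cardsX cardsT card_ffun !card_ord.
move=> x [Q /= QE Qx] nB; have [c Qc] := subcube_cover j0 Qx.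
rewrite ltNge; apply/negP => h; apply: nB; exists (Q, c) => //=.
rewrite inE QE/=; apply/asboolP; apply: le_trans _ h; apply: le_measure.
- by rewrite inE; exact: measurable_subcube.
- by rewrite inE; exact: measurable_sup_ball.
- exact: subcube_sub_sup_ball.
Qed.

End sparse_subcubes.

(** At the dyadic scale m only the levels n <= m are treated, so the bad sets of one scale form a
    finite union. This is enough because r_n <= 2^-n. *)
Lemma borel_cantelli_ae2 dd (T : measurableType dd) (R : realType)
    (mu : {measure set T -> \bar R}) (B : nat -> nat -> set T) (u : nat -> nat -> R) :
  (forall n m, measurable (B n m)) ->
  (forall n m, (mu (B n m) <= (u n m)%:E)%E) ->
  (\sum_(m <oo) (\sum_(n < m.+1) u n m)%:E < +oo)%E ->
  {ae mu, forall x, exists m0, forall m n,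
    (m0 <= m)%N -> (n <= m)%N -> ~ B n m x}.
Proof.
move=> mB Bu su; pose C m := \big[setU/set0]_(n < m.+1) B n m.
have mC m : measurable (C m) by exact: bigsetU_measurable.
have : {ae mu, forall x, exists m0, forall m, (m0 <= m)%N -> ~ C m x}.
  apply: borel_cantelli_ae => //; apply: le_lt_trans su.
  apply: lee_nneseries => // m _; rewrite -sumEFin.
  apply: (le_trans (Boole_inequality (A := fun n => B n m) _ _)) => [i _|].
    exact: mB.
  by apply: lee_sum => i _; exact: Bu.
apply: filterS => x [m0 h]; exists m0 => m n m0m nm Bx; apply: (h m m0m).
by rewrite /C -(@bigcup_mkord _ _ (fun n => B n m)); exists n.
Qed.

Section almost_every_point.
Variables (R : realType) (d : nat) (M N : nat -> nat).
Hypothesis hM : forall k, (1 <= k)%N -> (2 <= M k)%N.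
Hypothesis hN : forall k, (1 <= k)%N -> (1 <= N k <= M k ^ d)%N.
Variables (E : Omega hN) (mu : {measure set (Rn R d) -> \bar R}).
Hypothesis hmu : natural_measure E mu.

Local Notation cset := (@cube_set R d M _).
Local Notation s := (side R M).

(** The light subcubes at level n and scale m have total mass at most 1 / [weight m]. Scale m
    involves m + 1 levels, and the series of (m + 1) / [weight m] converges. *)
Lemma ae_mu_sup_ball_gt : {ae mu, forall x, exists m0, forall m n,
  (m0 <= m)%N -> (n <= m)%N -> level_set E n x ->
  (((weight R m)^-1 / (nb_cubes N n * (2 ^ m %/ res M n).+1 ^ d)%:R)%:E <
   mu (sup_ball x (2 ^- m)))%E}.
Proof.
(* Then [j n m] times [res M n] exceeds 2^m, so the subcubes have side at most 2^-m. *)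
pose j n m := (2 ^ m %/ res M n).+1.
have w0 m : 0 <= (weight R m)^-1 by rewrite invr_ge0 ltW// weight_gt0.
pose B n m := sval (cid (sparse_subcubes hM E mu n (ltn0Sn _ : (0 < j n m)%N) (w0 m))).
have BP n m := svalP (cid (sparse_subcubes hM E mu n (ltn0Sn _ : (0 < j n m)%N) (w0 m))).
have : {ae mu, forall x, exists m0, forall m n,
    (m0 <= m)%N -> (n <= m)%N -> ~ B n m x}.
  apply: (borel_cantelli_ae2 (u := fun n m => (weight R m)^-1)) => [n m|n m|].
  - by have [] := BP n m.
  - by have [] := BP n m.
  under eq_eseriesr do rewrite sumr_const card_ord -[X in X%:E]mulr_natl -[X in X%:E]mul1r.
  exact: nneseries_inv_weight.
apply: filterS => x [m0 h]; exists m0 => m n m0m nm Ex.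
have [_ _ /(_ x Ex (h _ _ m0m nm)) lt_mu] := BP n m.
apply: lt_le_trans lt_mu _; apply: le_measure.
- by rewrite inE; exact: measurable_sup_ball.
- by rewrite inE; exact: measurable_sup_ball.
apply: sub_sup_ball; rewrite /side -invfM lef_pV2 ?posrE.
- by rewrite -natrM -natrX ler_nat mulnC ltnW// ltn_ceil// (res_gt0 hM).
- by rewrite mulr_gt0 ?ltr0n ?(res_gt0 hM).
- by rewrite exprn_gt0.
Qed.

(** Pairs are ordered, and the diagonal is included. *)
Definition near_pairs n i (A : {set cube d M n}) : nat :=
  \sum_(Q in A) #|[set Q' in A | near_cubes i Q Q']%SET|.

(** One unit makes the multiple of r_(n+1) exceed 2^-m, the other is the one lost in
    [near_cubes_of_close]. *)
Definition near_radius n m : nat := (res M n.+1 %/ 2 ^ m).+2.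

(* An upper bound for the expected number of cubes of E_(n+1) near a given one. *)
Definition near_mean n m : R :=
  1 + (((near_radius n m).*2.+1) ^ d)%:R * (N n.+1)%:R / (M n.+1 ^ d)%:R.

(** Normalised so that its expectation is at most 1 / [weight m]. *)
Definition near_excess n m (A : {set cube d M n.+1}) : R :=
  (near_pairs (near_radius n m) A)%:R /
    (weight R m * near_mean n m * (nb_cubes N n.+1)%:R).

Lemma near_mean_ge1 n m : 1 <= near_mean n m.
Proof. by rewrite lerDl divr_ge0// mulr_ge0. Qed.

Lemma near_mean_gt0 n m : 0 < near_mean n m.
Proof. exact: lt_le_trans (near_mean_ge1 n m). Qed.

(** A cube of E_(n+1) is crowded when more than [weight m] times [near_mean n m] chosen cubes are
    near it. By Markov's inequality crowded cubes form a proportion at most [near_excess], and each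
    cube has mass at most 7^d / P_(n+1). By Borel-Cantelli almost every point eventually avoids the
    crowded cubes. *)
Lemma ae_mu_sup_ball_le :
  (\sum_(m <oo) (\sum_(n < m.+1) near_excess m (sval E n.+1))%:E < +oo)%E ->
  {ae mu, forall x, exists m0, forall m n,
    (m0 <= m)%N -> (n <= m)%N -> level_set E n.+1 x ->
    (mu (sup_ball x (2 ^- m)) <=
     (weight R m * near_mean n m / (nb_cubes N n.+1)%:R)%:E)%E}.
Proof.
move=> sZ.
pose t n m := weight R m * near_mean n m.
have t0 n m : 0 < t n m by rewrite mulr_gt0 ?weight_gt0 ?near_mean_gt0.
pose c n m (Q : cube d M n.+1) :=
  #|[set Q' in sval E n.+1 | near_cubes (near_radius n m) Q Q']%SET|.
pose S n m : {set cube d M n.+1} :=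
  [set Q in sval E n.+1 | t n m < (c n m Q)%:R]%SET.
pose B n m := \bigcup_(Q in [set` S n m]) cset Q.
have mQ n (Q : cube d M n) : measurable (cset Q) by exact: measurable_cube_set.
have : {ae mu, forall x, exists m0, forall m n,
    (m0 <= m)%N -> (n <= m)%N -> ~ B n m x}.
  apply: (borel_cantelli_ae2
    (u := fun n m => (7 ^ d)%:R * near_excess m (sval E n.+1))) => [n m|n m|].
  - exact: measurable_finset_bigcup.
  - apply: (@le_trans _ _ (\sum_(Q in S n m) mu (cset Q))%E).
      by apply: le_measure_finset_bigcup => //; exact: measurable_finset_bigcup.
    apply: (@le_trans _ _
      (\sum_(Q in S n m) ((7 ^ d)%:R / (nb_cubes N n.+1)%:R)%:E)%E).
      by apply: lee_sum => Q _; exact: (mu_cube_set_le hM hmu).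
    rewrite sumEFin lee_fin sumr_const -[leLHS]mulr_natl mulrCA.
    rewrite ler_wpM2l//; rewrite /near_excess [X in _ <= _ / X]mulrC invfM [leRHS]mulrA.
    rewrite mulrAC ler_wpM2r ?invr_ge0//; rewrite ler_pdivlMr//.
    rewrite mulr_natl -sumr_const /near_pairs natr_sum.
    (* Markov's inequality: keep only the crowded cubes in the count of near pairs. *)
    rewrite [leRHS](bigID (mem (S n m)))/=; apply: ler_wpDr; first exact: sumr_ge0.
    rewrite [leRHS](eq_bigl (mem (S n m))); last first.
      by move=> Q /=; rewrite !inE andbA andbb.
    by apply: ler_sum => Q; rewrite inE => /andP[_ /ltW].
    exact: t0.
  - under eq_eseriesr do rewrite -mulr_sumr EFinM.
    rewrite nneseriesZl//; first by rewrite lte_mul_pinfty.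
    move=> m _; rewrite lee_fin sumr_ge0// => n _.
    by rewrite divr_ge0// mulr_ge0// ltW// t0.
apply: filterS => x [m0 h]; exists m0 => m n m0m nm [Q /= QE Qx].
have xm : 2 ^- m < (res M n.+1 %/ 2 ^ m).+1%:R * s n.+1.
  rewrite /side ltr_pdivlMr ?ltr0n ?(res_gt0 hM)//.
  rewrite mulrC ltr_pdivrMr ?exprn_gt0// -natrX -natrM ltr_nat.
  by rewrite ltn_ceil// expn_gt0.
apply: le_trans (mu_sup_ball_le_near hM hmu Qx xm) _.
rewrite lee_fin ler_pM2r ?invr_gt0 ?ltr0n ?(nb_cubes_gt0 hN)//.
rewrite leNgt; apply/negP => lt_t; apply: (h _ _ m0m nm); exists Q => //=.
by rewrite inE QE.
Qed.

End almost_every_point.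

(** * Random realizations *)

Section draws.
Variable T : finType.

(** The quotient of the binomials is the product of (k - i) / (K - i) for i < x, and each factor is
    at most k / K. *)
Lemma bin_sub_le (K k x : nat) : (x <= k)%N -> (k <= K)%N ->
  ('C(K - x, k - x) * K ^ x <= 'C(K, k) * k ^ x)%N.
Proof.
elim: x => [|x IHx] xk kK; first by rewrite !subn0.
have Kx : (0 < K - x)%N by rewrite subn_gt0 (leq_trans xk).
have {}IHx := IHx (ltnW xk) kK.
have diag : ((K - x) * 'C(K - x.+1, k - x.+1) = (k - x) * 'C(K - x, k - x))%N.
  by rewrite !subnS mul_bin_diag prednK// subn_gt0.
have frac : ((k - x) * K <= k * (K - x))%N.
  rewrite mulnBl mulnBr leq_sub2l// mulnC leq_mul2l kK orbT//.
rewrite -(leq_pmul2l Kx) mulnA diag expnS.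
apply: (@leq_trans ((k - x) * K * ('C(K - x, k - x) * K ^ x))).
  by rewrite -!mulnA leq_mul2l mulnCA leqnn orbT.
apply: leq_trans (leq_mul frac IHx) _.
by rewrite expnS mulnC [(k * (K - x))%N]mulnC; lia.
Qed.

(** A uniform draw of k elements of D contains X with probability at most (k / #|D|)^#|X|, as if
    elements were drawn independently. Removing X injects these draws into the subsets of D \ X of
    size k - #|X|. *)
Lemma card_draws_containing (D X : {set T}) (k : nat) : X \subset D ->
  (#|[set S : {set T} | [&& S \subset D, #|S| == k & X \subset S]]%SET| *
     #|D| ^ #|X| <= 'C(#|D|, k) * k ^ #|X|)%N.
Proof.
move=> XD; case: (leqP #|X| k) => Xk; last first.
  rewrite (_ : [set S | _]%SET = finset.set0) ?cards0//.
  apply/setP => S; rewrite !inE; apply/and3P => -[_ /eqP Sk /subset_leq_card].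
  by rewrite Sk leqNgt Xk.
case: (leqP k #|D|) => kD; last first.
  rewrite (_ : [set S | _]%SET = finset.set0) ?cards0//.
  apply/setP => S; rewrite !inE; apply/and3P => -[/subset_leq_card + /eqP Sk _].
  by rewrite Sk leqNgt kD.
apply: leq_trans _ (bin_sub_le Xk kD); rewrite leq_mul2r; apply/orP; right.
set L := [set S | _]%SET.
have finj : {in L &, injective (fun S => S :\: X)%SET}.
  move=> S S'; rewrite !inE => /and3P[_ _ XS] /and3P[_ _ XS'] e.
  rewrite -(finset.setID S X) -(finset.setID S' X) e.
  by rewrite (finset.setIidPr XS) (finset.setIidPr XS').
rewrite -(card_in_imset finj).
have -> : (#|D| - #|X|)%N = #|D :\: X|%SET by rewrite cardsD (finset.setIidPr XD).
rewrite -cards_draws; apply: subset_leq_card; apply/fintype.subsetP => B.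
move=> /imsetP[S + ->]; rewrite !inE => /and3P[SD /eqP Sk XS].
by rewrite finset.setSD//= cardsD (finset.setIidPr XS) Sk.
Qed.

End draws.

Section random_cantor.
Variables (R : realType) (d : nat) (M N : nat -> nat).
Hypothesis hN : forall k, (1 <= k)%N -> (1 <= N k <= M k ^ d)%N.
Variables (P : probability (Omega hN) R) (hP : random_cantor_law P).

Lemma measurable_level n (p : {set cube d M n} -> Prop) :
  measurable [set E : Omega hN | p (sval E n)].
Proof.
rewrite (_ : mkset _ = \bigcup_(A in [set A | p A]) [set E : Omega hN | sval E n = A]).
  apply: fin_bigcup_measurable => // A _; apply: sub_sigma_algebra.
  by exists n, A.
by apply/seteqP; split=> [E pE|E [A pA] /= ->//]; exists (sval E n).
Qed.

(** Since N >= 1, every chosen cube has a chosen child, so E_n is the set of parents of E_(n+1).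
    Conditioning on the history is thus conditioning on the last level. *)
Lemma level_determines_history (A : Omega hN) n :
  history A n = [set E | sval E n = sval A n].
Proof.
apply/seteqP; split=> E; first by apply.
suff down m : sval E m.+1 = sval A m.+1 -> sval E m = sval A m.
  elim: n => [|n IHn] /= en k; first by rewrite leqn0 => /eqP->.
  by rewrite leq_eqVlt => /orP[/eqP->//|]; exact/IHn/down.
have lvl (B : Omega hN) : sval B m = (@parent d M m @: sval B m.+1)%SET.
  apply/setP => Q; apply/idP/imsetP => [QB|[Q' Q'B ->]]; last first.
    exact: (parent_in (svalP B) Q'B).
  have : (0 < #|sval B m.+1 :&: children Q|)%N.
    by rewrite ((svalP B).2 m).2//; have /andP[] := hN (ltn0Sn m).
  rewrite card_gt0 => /set0Pn[Q']; rewrite inE in_children => /andP[Q'B /eqP <-].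
  by exists Q'.
by move=> e; rewrite !lvl e.
Qed.

Local Notation frac n := ((N n)%:R / (M n ^ d)%:R : R).

(** Given E_n, the parts of X below different cubes are selected independently, each with the
    probability bounded by [card_draws_containing]; the exponents add up to #|X|. *)
Lemma prob_step (A : Omega hN) n (X : {set cube d M n.+1}) :
  (forall Q, Q \in X -> parent Q \in sval A n) ->
  (P [set E : Omega hN | sval E n = sval A n /\ X \subset sval E n.+1] <=
   (frac n.+1 ^+ #|X|)%:E * P [set E : Omega hN | sval E n = sval A n])%E.
Proof.
move=> XA; set A' := sval A n; set C : nat := 'C(M n.+1 ^ d, N n.+1).
have C0 : (0 < C)%N by rewrite bin_gt0; have /andP[] := hN (ltn0Sn n).
have K0 : (0 < M n.+1 ^ d)%N by have /andP[a b] := hN (ltn0Sn n); exact: leq_trans b.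
(* Admissible choices below Q. Cubes outside E_n get the single value empty set, so they contribute
   a factor 1 to the size of the family. *)
pose F Q : {set {set cube d M n.+1}} := if Q \in A' then
  [set S : {set cube d M n.+1} | [&& S \subset children Q, #|S| == N n.+1 &
      (X :&: children Q) \subset S]]%SET else [set finset.set0]%SET.
pose ev (B : {ffun cube d M n -> {set cube d M n.+1}}) := history A n `&`
         [set E | forall Q, Q \in sval A n ->
                    (sval E n.+1 :&: children Q)%SET = B Q].
pose fam : {set {ffun cube d M n -> {set cube d M n.+1}}} := [set B in family F]%SET.
have evE B : B \in fam -> P (ev B) = (P (history A n) *
       (\prod_(Q in A') (C%:R^-1 : R))%:E)%E.
  rewrite inE => /familyP BF; apply: hP => Q QA; have := BF Q.
  by rewrite /F QA inE => /and3P[? /eqP].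
have mev B : measurable (ev B).
  apply: measurableI.
    rewrite level_determines_history.
    exact: (@measurable_level n (fun Y => Y = A')).
  exact: (@measurable_level n.+1
    (fun Y => forall Q, Q \in A' -> (Y :&: children Q)%SET = B Q)).
apply: (@le_trans _ _ (\sum_(B in fam) P (ev B))%E).
  apply: le_measure_finset_bigcup => //.
    rewrite (_ : mkset _ = [set E : Omega hN | sval E n = A'] `&`
      [set E : Omega hN | X \subset sval E n.+1])//.
    apply: measurableI; first exact: (@measurable_level n (fun Y => Y = A')).
    exact: (@measurable_level n.+1 (fun Y => X \subset Y)).
  move=> E [En XE]; exists [ffun Q => if Q \in A' then
    sval E n.+1 :&: children Q else finset.set0]%SET.
    rewrite /= inE; apply/familyP => Q; rewrite ffunE /F.
    case: ifPn => [QA|_]; last by rewrite inE.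
    rewrite inE finset.subsetIr ((svalP E).2 n).2 ?En// eqxx/=.
    exact: finset.setSI.
  split; first by rewrite level_determines_history.
  by move=> Q QA; rewrite ffunE QA.
rewrite (eq_bigr (fun=> (P (history A n) * (\prod_(Q in A') (C%:R^-1 : R))%:E)%E)); last first.
  by move=> B; exact: evE.
rewrite level_determines_history.
have -> : P [set E | sval E n = sval A n] = (fine (P [set E | sval E n = sval A n]))%:E.
  by rewrite fineK// fin_num_measure//; exact: (@measurable_level n (fun Y => Y = A')).
rewrite -!EFinM sumEFin lee_fin sumr_const -[leLHS]mulr_natl mulrCA mulrC ler_wpM2r//.
  by rewrite fine_ge0.
(* The number of choice functions is a product over Q, and so is the probability of each; the bound
   is then proved factor by factor. *)
rewrite cardsE card_family foldrE big_map big_enum/=.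
rewrite (bigID (mem A'))/= [X in (_ * X)%N]big1 ?muln1; last first.
  by move=> Q /negbTE QA; rewrite /F QA cards1.
rewrite natr_prod -big_split/=.
have -> : #|X| = \sum_(Q in A') #|X :&: children Q|%SET.
  rewrite -sum1_card (partition_big (@parent d M n) (mem A'))//=; apply: eq_bigr => Q QA.
  by rewrite -sum1_card; apply: eq_bigl => Q'; rewrite finset.in_setI in_children.
rewrite expr_sum; apply: ler_prod => Q QA; rewrite mulr_ge0 ?invr_ge0//=.
have sub : X :&: children Q \subset children Q by exact: finset.subsetIr.
have := card_draws_containing (N n.+1) sub; rewrite /F QA card_children => h.
rewrite ler_pdivrMr ?ltr0n// expr_div_n mulrAC ler_pdivlMr ?exprn_gt0 ?ltr0n//.
by rewrite -!natrX -!natrM ler_nat [leqRHS]mulnC.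
Qed.

End random_cantor.

Section expectations.
Variables (R : realType) (d : nat) (M N : nat -> nat).
Hypothesis hN : forall k, (1 <= k)%N -> (1 <= N k <= M k ^ d)%N.
Variables (P : probability (Omega hN) R) (hP : random_cantor_law P).

Local Notation frac n := ((N n)%:R / (M n ^ d)%:R : R).

Lemma measurable_fun_level n (g : {set cube d M n} -> R) :
  measurable_fun [set: Omega hN] (fun E : Omega hN => (g (sval E n))%:E).
Proof.
apply/measurable_EFinP => _ Y mY; rewrite setTI.
exact: (@measurable_level d M N hN n (fun A => Y (g A))).
Qed.

(** Sum [prob_step] over the values of E_n containing all parents of X; values taken by no outcome
    give empty events. *)
Lemma prob_contains n (X : {set cube d M n.+1}) :
  (P [set E : Omega hN | X \subset sval E n.+1] <=
   (frac n.+1 ^+ #|X|)%:E *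
     P [set E : Omega hN | (@parent d M n @: X)%SET \subset sval E n])%E.
Proof.
have mE m (p : {set cube d M m} -> Prop) := @measurable_level d M N hN m p.
pose F (A : {set cube d M n}) := [set E : Omega hN | sval E n = A].
pose G (A : {set cube d M n}) :=
  [set E : Omega hN | sval E n = A /\ X \subset sval E n.+1].
pose S : {set {set cube d M n}} :=
  [set A : {set cube d M n} | @parent d M n @: X \subset A]%SET.
have mF A : measurable (F A) by exact: (mE n (fun Y => Y = A)).
have mG A : measurable (G A).
  rewrite (_ : G A = F A `&` [set E : Omega hN | X \subset sval E n.+1])//.
  by apply: measurableI => //; exact: (mE n.+1 (fun Y => X \subset Y)).
apply: (@le_trans _ _ (\sum_(A in S) P (G A))%E).
  apply: le_measure_finset_bigcup => //; first exact: (mE n.+1 (fun Y => X \subset Y)).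
  move=> E /= XE; exists (sval E n) => //=; rewrite inE.
  apply/fintype.subsetP => _ /imsetP[Q QX ->]; apply: (parent_in (svalP E)).
  exact: (fintype.subsetP XE).
apply: (@le_trans _ _ (\sum_(A in S) (frac n.+1 ^+ #|X|)%:E * P (F A))%E).
  apply: lee_sum => A; rewrite inE => XA.
  have [[A0 A0A]|nA] := pselect (exists E : Omega hN, sval E n = A).
    rewrite /G /F -A0A; apply: prob_step => // Q QX; rewrite A0A.
    by apply: (fintype.subsetP XA); exact: imset_f.
  rewrite (_ : G A = set0) ?measure0 ?mule_ge0 ?lee_fin ?exprn_ge0 ?divr_ge0//.
  by apply/seteqP; split=> // E [EA _]; apply: nA; exists E.
rewrite -ge0_sume_distrr// lee_wpmul2l ?lee_fin ?exprn_ge0 ?divr_ge0//.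
rewrite -measure_finset_bigcup//; last by move=> A A' _ _ [E [/= <- <-]].
apply: le_measure; rewrite ?inE.
- exact: measurable_finset_bigcup.
- exact: (mE n (fun Y => (@parent d M n @: X)%SET \subset Y)).
- by move=> E [A AS /= EA]; move: AS; rewrite /= inE -EA.
Qed.

Lemma sum_probability (I : finType) (p : pred I) (B : I -> set (Omega hN)) :
  (forall i, measurable (B i)) ->
  (\sum_(i | p i) P (B i) = \int[P]_E (\sum_(i | p i) \1_(B i) E)%:E)%E.
Proof.
move=> mB; under [RHS]eq_integral do rewrite -sumEFin -big_filter.
rewrite ge0_integral_sum//=; last first.
  by move=> i; apply/measurable_EFinP; exact: measurable_indic.
by rewrite -big_filter; apply: eq_bigr => i _; rewrite integral_indic// setIT.
Qed.

(** The sum is the expected number of cubes of E_n, and that number is deterministic. *)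
Lemma sum_prob_mem n :
  (\sum_(Q : cube d M n) P [set E : Omega hN | Q \in sval E n] =
   (nb_cubes N n)%:R%:E)%E.
Proof.
have mE (Q : cube d M n) := @measurable_level d M N hN n (fun Y => Q \in Y).
rewrite sum_probability//.
under eq_integral => E _.
  rewrite (_ : \sum_i _ = (nb_cubes N n)%:R); last first.
    rewrite -(card_realization (svalP E)) -sum1_card natr_sum.
    rewrite [RHS]big_mkcond/=; apply: eq_bigr => Q _.
    by rewrite indicE; case: ifP => QE; [rewrite mem_set|rewrite memNset//= QE].
  over.
by rewrite integral_cst// [X in (_ * X)%E](probability_setT P) mule1.
Qed.

Lemma sum_prob_parent n :
  (\sum_(Q : cube d M n.+1) P [set E : Omega hN | parent Q \in sval E n] =
   ((M n.+1 ^ d)%:R * (nb_cubes N n)%:R)%:E)%E.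
Proof.
rewrite (partition_big (@parent d M n) xpredT)//= EFinM -sum_prob_mem.
rewrite ge0_sume_distrr//; apply: eq_bigr => Q _.
rewrite (eq_bigr (fun=> P [set E : Omega hN | Q \in sval E n])); last first.
  by move=> Q' /eqP ->.
rewrite -[in RHS](card_children Q) -sumr_const -sumEFin ge0_sume_distrl//.
apply: eq_big => [Q'|Q' _]; first by rewrite in_children.
by rewrite mul1e.
Qed.

(** With f = N_(n+1) / M_(n+1)^d, the diagonal contributes P_(n+1). Any other pair has probability
    at most f^2 times that of the parent of Q being chosen, and there are at most (2i+1)^d near
    cubes for each Q. Summing over Q gives f^2 M_(n+1)^d P_n = f P_(n+1). *)
Lemma expected_near_pairs n i :
  (\int[P]_E (near_pairs i (sval E n.+1))%:R%:E <=
   ((nb_cubes N n.+1)%:R * (1 + ((i.*2.+1) ^ d)%:R * frac n.+1))%:E)%E.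
Proof.
have mE (X : {set cube d M n.+1}) := @measurable_level d M N hN n.+1 (fun Y => X \subset Y).
pose p (q : cube d M n.+1 * cube d M n.+1) := near_cubes i q.1 q.2.
pose B (q : cube d M n.+1 * cube d M n.+1) :=
  [set E : Omega hN | [set q.1; q.2]%SET \subset sval E n.+1].
pose f := frac n.+1.
have f0 : 0 <= f by rewrite divr_ge0.
have -> : (\int[P]_E (near_pairs i (sval E n.+1))%:R%:E =
    \sum_(Q : cube d M n.+1) \sum_(Q' : cube d M n.+1 | near_cubes i Q Q') P (B (Q, Q')))%E.
  rewrite pair_big_dep/= (eq_bigr (fun q => P (B q))) => [|[]//].
  rewrite (sum_probability p (B := B) (fun q => mE _)); apply: eq_integral => E _; congr (_%:E).
  rewrite /near_pairs natr_sum big_mkcond/= /p -(pair_big_dep xpredT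
    (fun Q Q' => near_cubes i Q Q') (fun Q Q' => \1_(B (Q, Q')) E))/=.
  apply: eq_bigr => Q _; case: ifPn => QE.
    rewrite -sum1_card natr_sum big_mkcond [RHS]big_mkcond/=; apply: eq_bigr => Q' _.
    rewrite inE indicE; case: (near_cubes i Q Q'); rewrite ?andbF//= andbT.
    case: ifPn => Q'E; [rewrite mem_set//=|rewrite memNset//=].
      by apply/fintype.subsetP => Q2; rewrite !inE => /orP[] /eqP ->.
    by move=> /fintype.subsetP/(_ Q'); rewrite !inE eqxx orbT (negbTE Q'E) => /(_ isT).
  rewrite big1// => Q' _; rewrite indicE memNset//= => /fintype.subsetP/(_ Q).
  by rewrite !inE eqxx (negbTE QE) => /(_ isT).
have bound Q : (\sum_(Q' : cube d M n.+1 | near_cubes i Q Q') P (B (Q, Q')) <=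
    P [set E : Omega hN | Q \in sval E n.+1] +
    ((i.*2.+1 ^ d)%:R * f ^+ 2)%:E * P [set E : Omega hN | parent Q \in sval E n])%E.
  rewrite (bigD1 Q)/=; last by apply/forallP => l; rewrite leq_addr.
  apply: leeD.
    rewrite (_ : B (Q, Q) = [set E : Omega hN | Q \in sval E n.+1])//.
    by apply/seteqP; split=> E; rewrite /B/= finset.setUid finset.sub1set.
  apply: (@le_trans _ _ (\sum_(Q' : cube d M n.+1 | near_cubes i Q Q')
      (f ^+ 2)%:E * P [set E : Omega hN | parent Q \in sval E n])%E).
    rewrite [leLHS]big_mkcond [leRHS]big_mkcond/=; apply: lee_sum => Q' _.
    case: (near_cubes i Q Q') => //=; case: ifPn => [QQ'|_]; last first.
      by rewrite mule_ge0// lee_fin exprn_ge0.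
    (* Only the parent of Q is kept in the event; dropping that of Q' covers equal and different
       parents alike. *)
    apply: le_trans (prob_contains _) _; rewrite cards2 eq_sym QQ'/=.
    rewrite lee_wpmul2l ?lee_fin ?exprn_ge0//; apply: le_measure; rewrite ?inE.
    - exact: (@measurable_level d M N hN n (fun Y => (@parent d M n @: _)%SET \subset Y)).
    - exact: (@measurable_level d M N hN n (fun Y => parent Q \in Y)).
    - move=> E /= /fintype.subsetP; apply; apply: imset_f.
      by rewrite !inE eqxx.
  rewrite -ge0_sume_distrl; last by move=> *; rewrite lee_fin exprn_ge0.
  rewrite lee_wpmul2r// sumEFin lee_fin sumr_const -[leLHS]mulr_natl.
  rewrite ler_wpM2r ?exprn_ge0// ler_nat.
  apply: leq_trans _ (card_near_cubes i Q); apply: eq_leq; apply: eq_card => Q'.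
  by rewrite !inE.
apply: (@le_trans _ _ (\sum_(Q : cube d M n.+1)
    (P [set E : Omega hN | Q \in sval E n.+1] +
    ((i.*2.+1 ^ d)%:R * f ^+ 2)%:E * P [set E : Omega hN | parent Q \in sval E n]))%E).
  by apply: lee_sum => Q _; exact: bound.
rewrite big_split/= sum_prob_mem -ge0_sume_distrr// sum_prob_parent.
rewrite -EFinM -EFinD lee_fin mulrDr mulr1 lerD2l.
have K0 : (M n.+1 ^ d)%:R != 0 :> R.
  by rewrite pnatr_eq0 -lt0n; have /andP[a b] := hN (ltn0Sn n); exact: leq_trans b.
rewrite nb_cubesS natrM /f le_eqVlt; apply/orP; left; apply/eqP.
move: K0; move: ((M n.+1 ^ d)%:R) ((i.*2.+1 ^ d)%:R) => K D K0.
by field.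
Qed.

Lemma expected_near_excess n m :
  (\int[P]_E (near_excess R N m (sval E n.+1))%:E <= (weight R m)^-1%:E)%E.
Proof.
have w0 := weight_gt0 R m; have m0 := near_mean_gt0 R d M N n m.
have nb0 : 0 < (nb_cubes N n.+1)%:R :> R by rewrite ltr0n (nb_cubes_gt0 hN).
pose c := (weight R m * near_mean R d M N n m * (nb_cubes N n.+1)%:R)^-1.
have c0 : 0 <= c by rewrite invr_ge0 !mulr_ge0// ltW.
under eq_integral => E _ do rewrite /near_excess mulrC EFinM.
rewrite ge0_integralZl//; last first.
  exact: (@measurable_fun_level n.+1 (fun A => (near_pairs _ A)%:R)).
apply: (@le_trans _ _ (c%:E * ((nb_cubes N n.+1)%:R * near_mean R d M N n m)%:E)%E).
  rewrite lee_wpmul2l ?lee_fin//.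
  apply: le_trans (expected_near_pairs n (near_radius M n m)) _.
  by rewrite lee_fin /near_mean mulrA.
rewrite -EFinM lee_fin /c !invfM.
rewrite [leLHS](_ : _ = (weight R m)^-1)//.
by field; rewrite !gt_eqF.
Qed.

(** The double sum has finite expectation, hence is almost surely finite. This is the only
    probabilistic input to the final statement. *)
Lemma ae_near_excess_summable : {ae P, forall E : Omega hN,
  (\sum_(m <oo) (\sum_(n < m.+1) near_excess R N m (sval E n.+1))%:E < +oo)%E}.
Proof.
have e0 n m (A : {set cube d M n.+1}) : 0 <= near_excess R N m A.
  by rewrite divr_ge0// !mulr_ge0// ltW// ?weight_gt0// near_mean_gt0.
pose g m (E : Omega hN) := (\sum_(n < m.+1) near_excess R N m (sval E n.+1))%:E.
have g0 m E : (0 <= g m E)%E by rewrite lee_fin sumr_ge0.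
have mg m : measurable_fun [set: Omega hN] (g m).
  rewrite /g; under eq_fun do rewrite -sumEFin.
  by apply: emeasurable_sum => n; exact: (@measurable_fun_level n.+1 (near_excess R N m)).
have ig m : (\int[P]_E g m E <= (1 * (m.+1%:R / weight R m))%:E)%E.
  rewrite /g; under eq_integral do rewrite -sumEFin.
  rewrite ge0_integral_sum//=; first last.
  - by move=> n E _; rewrite lee_fin.
  - by move=> n; exact: (@measurable_fun_level n.+1 (near_excess R N m)).
  apply: (@le_trans _ _ (\sum_(n < m.+1) (weight R m)^-1%:E)%E).
    by apply: lee_sum => n _; exact: expected_near_excess.
  by rewrite sumEFin sumr_const card_ord lee_fin mul1r -[leLHS]mulr_natl.
have mG : measurable_fun [set: Omega hN] (fun E => \sum_(m <oo) g m E)%E.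
  by apply: ge0_emeasurable_sum => // m E _ _; exact: g0.
have iG : P.-integrable setT (fun E => \sum_(m <oo) g m E)%E.
  apply/integrableP; split=> //; under eq_integral do rewrite gee0_abs ?nneseries_ge0//.
  rewrite integral_nneseries//; apply: le_lt_trans (nneseries_inv_weight ler01).
  by apply: lee_nneseries => [m _ _|m _]; [exact: integral_ge0|exact: ig].
have := integrable_ae measurableT iG.
apply: filterS => E /(_ I); rewrite ge0_fin_numE//.
by apply: nneseries_ge0 => m _ _; exact: g0.
Qed.

End expectations.

(** * Local dimensions *)

Section limf_bounds.
Variables (T : choiceType) (X : filteredType T) (R : realType).
Implicit Types (f : X -> \bar R) (F : set (set X)) (c : \bar R).
Local Open Scope ereal_scope.

(** Reduces comparisons of possibly infinite upper and lower limits to inequalities with a real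
    y. *)
Lemma lte_real_between (a b : \bar R) : a < b -> exists y : R, a < y%:E < b.
Proof.
case: a b => [a| |] [b| |]//=.
- rewrite lte_fin => ab; exists ((a + b) / 2)%R; rewrite !lte_fin.
  by rewrite ltr_pdivlMr// ltr_pdivrMr// mulr2n !mulrDr !mulr1 ltrD2l ltrD2r ab.
- by move=> _; exists (a + 1)%R; rewrite lte_fin ltrDl ltr01 ltry.
- by move=> _; exists (b - 1)%R; rewrite lte_fin ltrBlDr ltrDl ltr01 ltNyr.
- by move=> _; exists 0%R; rewrite ltry ltNyr.
Qed.

Lemma limf_esup_lt f F c : limf_esup f F < c ->
  exists2 V, F V & forall x, V x -> f x < c.
Proof.
move=> /ereal_inf_lt[_ [V FV <-] lt_c]; exists V => // x Vx.
by apply: le_lt_trans lt_c; apply: ereal_sup_ubound; exists x.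
Qed.

Lemma lt_limf_esup f F c V : c < limf_esup f F -> F V ->
  exists2 x, V x & c < f x.
Proof.
move=> c_lt FV; have : c < ereal_sup (f @` V).
  by apply: lt_le_trans c_lt _; apply: ereal_inf_lbound; exists V.
by move=> /ereal_sup_gt[_ [x Vx <-] cx]; exists x.
Qed.

Lemma lt_limf_einf f F c : c < limf_einf f F ->
  exists2 V, F V & forall x, V x -> c < f x.
Proof.
rewrite /limf_einf lteNr => /limf_esup_lt[V FV h]; exists V => // x /h.
by rewrite lteN2.
Qed.

Lemma limf_einf_lt f F c V : limf_einf f F < c -> F V ->
  exists2 x, V x & f x < c.
Proof.
rewrite /limf_einf lteNl => /lt_limf_esup h /h[x Vx].
by rewrite lteN2 => fx; exists x.
Qed.

Lemma limf_esup_le f F c :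
  (forall y : R, c < y%:E -> exists2 V, F V & forall x, V x -> f x <= y%:E) ->
  limf_esup f F <= c.
Proof.
move=> h; rewrite leNgt; apply/negP => /lte_real_between[y /andP[/h[V FV Vy] y_lt]].
by have [x Vx] := lt_limf_esup y_lt FV; rewrite ltNge Vy.
Qed.

Lemma limf_esup_ge f F c :
  (forall (y : R) V, y%:E < c -> F V -> exists2 x, V x & y%:E <= f x) ->
  c <= limf_esup f F.
Proof.
move=> h; rewrite leNgt; apply/negP => /lte_real_between[y /andP[y_gt yc]].
have [V FV Vy] := limf_esup_lt y_gt; have [x Vx] := h y V yc FV.
by rewrite leNgt Vy.
Qed.

Lemma limf_einf_ge f F c :
  (forall y : R, y%:E < c -> exists2 V, F V & forall x, V x -> y%:E <= f x) ->
  c <= limf_einf f F.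
Proof.
move=> h; rewrite leNgt; apply/negP => /lte_real_between[y /andP[y_gt yc]].
have [V FV Vy] := h y yc.
by have [x Vx] := limf_einf_lt y_gt FV; rewrite ltNge Vy.
Qed.

Lemma limf_einf_le f F c :
  (forall (y : R) V, c < y%:E -> F V -> exists2 x, V x & f x <= y%:E) ->
  limf_einf f F <= c.
Proof.
move=> h; rewrite leNgt; apply/negP => /lte_real_between[y /andP[cy y_lt]].
have [V FV Vy] := lt_limf_einf y_lt; have [x Vx] := h y V cy FV.
by rewrite leNgt Vy.
Qed.

End limf_bounds.

Section sequence_bounds.
Variable R : realType.
Implicit Types (u : nat -> R) (c : \bar R) (y : R).

Lemma limn_esup_lt_eventually u y : (limn_esup (fun n => (u n)%:E) < y%:E)%E ->
  exists n0, forall n, (n0 <= n)%N -> u n <= y.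
Proof.
move=> /limf_esup_lt[V [n0 _ n0V] Vu]; exists n0 => n /n0V/Vu.
by rewrite lte_fin => /ltW.
Qed.

Lemma lt_limn_esup_frequently u y : (y%:E < limn_esup (fun n => (u n)%:E))%E ->
  forall n0, exists2 n, (n0 <= n)%N & y <= u n.
Proof.
move=> h n0; have /(lt_limf_esup h)[n /= n0n] : \oo [set n | (n0 <= n)%N] by exists n0.
by rewrite lte_fin => /ltW; exists n.
Qed.

Lemma lt_limn_einf_eventually u y : (y%:E < limn_einf (fun n => (u n)%:E))%E ->
  exists n0, forall n, (n0 <= n)%N -> y <= u n.
Proof.
move=> /lt_limf_einf[V [n0 _ n0V] Vu]; exists n0 => n /n0V/Vu.
by rewrite lte_fin => /ltW.
Qed.

Lemma limn_einf_lt_frequently u y : (limn_einf (fun n => (u n)%:E) < y%:E)%E ->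
  forall n0, exists2 n, (n0 <= n)%N & u n <= y.
Proof.
move=> h n0; have /(limf_einf_lt h)[n /= n0n] : \oo [set n | (n0 <= n)%N] by exists n0.
by rewrite lte_fin => /ltW; exists n.
Qed.

End sequence_bounds.

Section dimension_bounds.
Variables (R : realType) (d : nat) (mu : {measure set (Rn R d) -> \bar R}).
Variable x : Rn R d.
Hypothesis mu_fin : forall r : R, 0 < r -> (0 < mu (cball x r) < +oo)%E.

(* In the variable rho = - ln r, the local dimensions are the limits of
   [log_mass rho / rho] as rho tends to infinity. *)
Definition log_mass (rho : R) : R := - ln (fine (mu (cball x (expR (- rho))))).

Lemma log_mass_mu rho : fine (mu (cball x (expR (- rho)))) = expR (- log_mass rho).
Proof.
have /andP[m0 moo] := mu_fin (expR_gt0 (- rho)).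
by rewrite /log_mass opprK lnK// posrE fine_gt0// m0.
Qed.

Lemma log_mass_le rho y :
  (log_mass rho <= y) = ((expR (- y))%:E <= mu (cball x (expR (- rho))))%E.
Proof.
have /andP[m0 moo] := mu_fin (expR_gt0 (- rho)).
rewrite -[X in _ = (_ <= X)%E]fineK ?ge0_fin_numE//.
by rewrite lee_fin log_mass_mu ler_expR lerN2.
Qed.

Lemma log_mass_ge rho y :
  (y <= log_mass rho) = (mu (cball x (expR (- rho))) <= (expR (- y))%:E)%E.
Proof.
have /andP[m0 moo] := mu_fin (expR_gt0 (- rho)).
rewrite -[X in _ = (X <= _)%E]fineK ?ge0_fin_numE//.
by rewrite lee_fin log_mass_mu ler_expR lerN2.
Qed.

Lemma log_mass_nondecreasing rho rho' : rho <= rho' -> log_mass rho <= log_mass rho'.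
Proof.
move=> rr; rewrite log_mass_ge -log_mass_mu fineK.
  apply: le_measure; rewrite ?inE; try exact: measurable_cball.
  by apply: sub_cball; rewrite ler_expR lerN2.
by have /andP[m0 moo] := mu_fin (expR_gt0 (- rho)); rewrite ge0_fin_numE// ltW.
Qed.

Let G (r : R) : \bar R := (lne (mu (cball x r)) * ((ln r)^-1)%:E)%E.

Lemma log_mass_ratio r : 0 < r -> r < 1 -> G r = (log_mass (- ln r) / - ln r)%:E.
Proof.
move=> r0 r1; have /andP[m0 moo] := mu_fin r0.
have mE : mu (cball x r) = (fine (mu (cball x r)))%:E.
  by rewrite fineK// ge0_fin_numE// ltW.
rewrite /G mE lne_EFin ?fine_gt0 ?m0// -EFinM /log_mass opprK lnK ?posrE//.
by rewrite invrN mulrNN.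
Qed.

Lemma log_mass_ratio_expR rho : 0 < rho -> G (expR (- rho)) = (log_mass rho / rho)%:E.
Proof.
move=> rho0; rewrite log_mass_ratio ?expR_gt0 ?expRK ?opprK//.
by rewrite expR_lt1 oppr_lt0.
Qed.

Lemma at_right0_of_rho (Q : R -> Prop) rho0 :
  (forall rho, rho0 <= rho -> 0 < rho -> Q rho) ->
  exists2 V, (0^'+) V & forall r, V r -> [/\ 0 < r, r < 1 & Q (- ln r)].
Proof.
move=> hQ; exists [set r | 0 < r < expR (- Num.max rho0 1)].
  near=> r; rewrite /=; apply/andP; split; near: r; first exact: nbhs_right_gt.
  exact: nbhs_right_lt (expR_gt0 _).
move=> r /= /andP[r0 rlt].
have rr : Num.max rho0 1 < - ln r.
  by rewrite ltrNr -[ltRHS]expRK ltr_ln ?posrE ?expR_gt0.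
move: rr; rewrite gt_max => /andP[h1 h2].
have l0 : 0 < - ln r := lt_trans ltr01 h2.
split=> //; last by apply: hQ => //; exact: ltW.
by rewrite -ltr_ln ?posrE// ln1 -oppr_gt0.
Unshelve. all: end_near. Qed.

Lemma at_right0_rho V : (0^'+) V ->
  exists2 rho0, 0 < rho0 & forall rho : R, rho0 <= rho -> V (expR (- rho)).
Proof.
move=> [e /= e0 eV]; exists (Num.max 1 (1 - ln e)); first by rewrite lt_max ltr01.
move=> rho; rewrite ge_max => /andP[_ h].
apply: eV; rewrite /= ?expR_gt0// sub0r normrN ger0_norm ?expR_ge0//.
by rewrite -[ltRHS]lnK ?posrE// ltr_expR; lra.
Qed.

Lemma lower_dim_ge c :
  (forall y : R, (y%:E < c)%E ->
    exists rho0, forall rho, rho0 <= rho -> 0 < rho -> y * rho <= log_mass rho) ->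
  (c <= lower_dim mu x)%E.
Proof.
move=> h; apply: limf_einf_ge => y /h[rho0 /at_right0_of_rho[V FV hV]].
exists V => // r /hV[r0 r1 hr]; rewrite -/(G r) log_mass_ratio// lee_fin.
by rewrite ler_pdivlMr// oppr_gt0 ln_lt0// r0.
Qed.

Lemma upper_dim_le c :
  (forall y : R, (c < y%:E)%E ->
    exists rho0, forall rho, rho0 <= rho -> 0 < rho -> log_mass rho <= y * rho) ->
  (upper_dim mu x <= c)%E.
Proof.
move=> h; apply: limf_esup_le => y /h[rho0 /at_right0_of_rho[V FV hV]].
exists V => // r /hV[r0 r1 hr]; rewrite -/(G r) log_mass_ratio// lee_fin.
by rewrite ler_pdivrMr// oppr_gt0 ln_lt0// r0.
Qed.

Lemma lower_dim_le c :
  (forall y rho0 : R, (c < y%:E)%E ->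
    exists rho, [/\ rho0 <= rho, 0 < rho & log_mass rho <= y * rho]) ->
  (lower_dim mu x <= c)%E.
Proof.
move=> h; apply: limf_einf_le => y V cy /at_right0_rho[rho0 rho00 hV].
have [rho [r1 r2 r3]] := h y rho0 cy; exists (expR (- rho)); first exact: hV.
by rewrite -/(G _) log_mass_ratio_expR// lee_fin ler_pdivrMr.
Qed.

Lemma upper_dim_ge c :
  (forall y rho0 : R, (y%:E < c)%E ->
    exists rho, [/\ rho0 <= rho, 0 < rho & y * rho <= log_mass rho]) ->
  (c <= upper_dim mu x)%E.
Proof.
move=> h; apply: limf_esup_ge => y V cy /at_right0_rho[rho0 rho00 hV].
have [rho [r1 r2 r3]] := h y rho0 cy; exists (expR (- rho)); first exact: hV.
by rewrite -/(G _) log_mass_ratio_expR// lee_fin ler_pdivlMr.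
Qed.

End dimension_bounds.

(** * Limits of H(t) / t from bounds on H at the construction scales *)

Section asymptotics.
Variables (R : realType) (D a : R) (L rho nu : nat -> R) (H : R -> R).
Hypothesis D0 : 0 < D.
Hypothesis a0 : 0 < a.
Hypothesis L0 : forall n, 0 <= L n.
Hypothesis LD : forall n, L n <= D * rho n.
Hypothesis LS : forall n, L n.+1 = L n + nu n.
Hypothesis rho_ge : forall n, n%:R * a <= rho n.
Hypothesis nu0 : forall n, 0 <= nu n.
Hypothesis nuD : forall n, D^-1 * nu n <= rho n.+1 - rho n.
Hypothesis H_nd : forall t u, t <= u -> H t <= H u.

(* The scales -ln (r_(n+1) N_(n+1)^(1/d)) and -ln (r_n N_(n+1)^(-1/d)). *)
Let low n := rho n.+1 - D^-1 * nu n.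
Let high n := rho n + D^-1 * nu n.

Lemma rho_low n : rho n <= low n.
Proof. by have := nuD n; rewrite /low; lra. Qed.

Lemma nu_div n : 0 <= D^-1 * nu n.
Proof. by rewrite mulr_ge0// invr_ge0 ltW. Qed.

Lemma rho_high n : rho n <= high n.
Proof. by have := nu_div n; rewrite /high; lra. Qed.

Lemma high_rho n : high n <= rho n.+1.
Proof. by have := nuD n; rewrite /high; lra. Qed.

Lemma mul_high n : D * high n = D * rho n + nu n.
Proof. by rewrite mulrDr mulrA divff ?mul1r// gt_eqF. Qed.

Lemma mul_low n : D * low n = D * rho n.+1 - nu n.
Proof. by rewrite mulrBr mulrA divff ?mul1r// gt_eqF. Qed.

Lemma rho_nd m n : (m <= n)%N -> rho m <= rho n.
Proof.
elim: n => [|n IHn]; first by rewrite leqn0 => /eqP ->.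
rewrite leq_eqVlt => /orP[/eqP->//|/IHn mn]; apply: le_trans mn _.
exact: le_trans (rho_high n) (high_rho n).
Qed.

Lemma rho_unbounded t : exists n0, forall n, (n0 <= n)%N -> t <= rho n.
Proof.
have [n0 n0t] : exists n0 : nat, t <= n0%:R * a.
  exists (Num.bound `|t / a|); rewrite -ler_pdivrMr//.
  apply: le_trans (ler_norm _) _; apply: ltW; exact: archi_boundP.
exists n0 => n n0n; apply: le_trans n0t (le_trans _ (rho_ge n)).
by rewrite ler_pM2r// ler_nat.
Qed.

Lemma rho_bracket k t : rho k <= t ->
  exists2 n, (k <= n)%N & rho n <= t < rho n.+1.
Proof.
move=> kt; have [n0 hn0] := rho_unbounded (t + 1).
have ex : exists n, t < rho n.+1.
  by exists n0; have := hn0 n0.+1 (leqnSn _); lra.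
pose n := ex_minn ex; have [nlt nmin] : t < rho n.+1 /\ forall j, t < rho j.+1 -> (n <= j)%N.
  by rewrite /n; case: ex_minnP.
exists n.
  by rewrite leqNgt; apply/negP => nk; have := lt_le_trans nlt (rho_nd nk); lra.
rewrite nlt andbT; case: n nmin {nlt} => [|n] nmin.
  exact: le_trans (rho_nd (leq0n k)) kt.
by rewrite leNgt; apply/negP => /nmin; rewrite ltnn.
Qed.

Variables (c C : R).
Hypothesis c0 : 0 <= c.
Hypothesis H_le : forall n, H (rho n - c) <= L n.
Hypothesis H_ge_fine : forall n t, rho n <= t -> L n - C <= H t.
Hypothesis H_ge_coarse : forall n t, t <= rho n -> L n - D * (rho n - t) - C <= H t.

Lemma frequently_le (y : R) (t0 : R) :
  (limn_einf (fun n => (L n / rho n)%:E) < y%:E)%E ->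
  exists t, [/\ t0 <= t, 0 < t & H t <= y * t].
Proof.
have cge := c0.
move=> /lte_real_between[y' /andP[hy']]; rewrite lte_fin => y'y.
(* The test point is t = rho n - c. The thresholds give t >= t0, t >= 1 and y' rho_n <= y (rho_n -
   c). *)
have [n0 hn0] := rho_unbounded (Num.max (t0 + c) (Num.max (c + 1) (y * c / (y - y')))).
have [n nn0] := limn_einf_lt_frequently hy' n0.
have := hn0 n nn0; rewrite !ge_max [X in [&& _, _ & X]]ler_pdivrMr ?subr_gt0//.
move=> /and3P[h1 h2 h3]; have rn : 0 < rho n by lra.
rewrite ler_pdivrMr// => Ln; exists (rho n - c); split; [lra|lra|].
by apply: le_trans (H_le n) _; nra.
Qed.

Lemma frequently_ge (y : R) (t0 : R) :
  (y%:E < limn_esup (fun n => (L n / rho n)%:E))%E ->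
  exists t, [/\ t0 <= t, 0 < t & y * t <= H t].
Proof.
move=> /lte_real_between[y' /andP[+ hy']]; rewrite lte_fin => y'y.
have [n0 hn0] := rho_unbounded (Num.max t0 (Num.max 1 (C / (y' - y)))).
have [n nn0] := lt_limn_esup_frequently hy' n0.
have := hn0 n nn0; rewrite !ge_max [X in [&& _, _ & X]]ler_pdivrMr ?subr_gt0//.
move=> /and3P[h1 h2 h3]; have rn : 0 < rho n by lra.
rewrite ler_pdivlMr// => Ln; exists (rho n); split => //.
by have := H_ge_fine (lexx (rho n)); nra.
Qed.

(** Up to [low n] the constant bound L_n - C suffices. Beyond it the coarse bound of level n+1
    equals L_n + D (t - low n) - C, whose slope D is at least y'. *)
Lemma eventually_ge_low (y : R) :
  (y%:E < limn_einf (fun n => (L n / low n)%:E))%E ->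
  exists t0, forall t, t0 <= t -> 0 < t -> y * t <= H t.
Proof.
move=> /lte_real_between[y' /andP[+ hy']]; rewrite lte_fin => yy'.
have [n0 hn0] := lt_limn_einf_eventually hy'.
exists (Num.max (rho n0.+1) (C / (y' - y))) => t.
rewrite ge_max [X in _ && X]ler_pdivrMr ?subr_gt0// => /andP[h1 h2] tp.
have [n n0n /andP[tn tn1]] := rho_bracket h1.
have rn : 0 < rho n.
  have := rho_ge n; have : 0 < n%:R * a by rewrite mulr_gt0// ltr0n (leq_trans _ n0n).
  lra.
have ln := rho_low n; have lp : 0 < low n by lra.
have := hn0 n (ltnW n0n); rewrite ler_pdivlMr// => Ln.
have yD : y' <= D.
  have := LD n => LDn; rewrite -(ler_pM2r lp); apply: (le_trans Ln); apply: (le_trans LDn).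
  by rewrite ler_pM2l.
(* The slope y' may be negative; its positive part obeys the same bounds and makes the products
   monotone. *)
pose z := Num.max y' 0.
have zy' : y' <= z by rewrite le_max lexx.
have z0 : 0 <= z by rewrite le_max lexx orbT.
have zD : z <= D by rewrite ge_max yD ltW.
have Lz : z * low n <= L n.
  by rewrite /z; case: (leP y' 0) => _ //; rewrite mul0r.
have [tl|lt] := leP t (low n).
  by have := H_ge_fine tn; nra.
have := H_ge_coarse (ltW tn1); rewrite LS => Hc.
have e := mul_low n; nra.
Qed.

Lemma eventually_le_next (y : R) :
  (limn_esup (fun n => (L n.+1 / rho n)%:E) < y%:E)%E ->
  exists t0, forall t, t0 <= t -> 0 < t -> H t <= y * t.
Proof.
have cge := c0.
move=> /lte_real_between[y' /andP[hy']]; rewrite lte_fin => yy'.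
have [n0 hn0] := limn_esup_lt_eventually hy'.
have [n1 hn1] := rho_unbounded (Num.max 1 (y * c / (y - y'))).
exists (Num.max 0 (rho (maxn n0 n1))) => t; rewrite ge_max => /andP[h0 h1] tp.
(* Bracketing t + c instead of t gives t <= rho_(n+1) - c, where [H_le] applies. *)
have h1' : rho (maxn n0 n1) <= t + c by lra.
have [n + /andP[tn tn1]] := rho_bracket h1'; rewrite geq_max => /andP[n0n n1n].
have := hn1 n n1n; rewrite ge_max [X in _ && X]ler_pdivrMr ?subr_gt0// => /andP[g1 g2].
have rn : 0 < rho n by lra.
have := hn0 n n0n; rewrite ler_pdivrMr// => Ln.
have tt : t <= rho n.+1 - c by lra.
have Hn := le_trans (H_nd tt) (H_le n.+1).
have Ln0 := L0 n.+1.
have y'0 : 0 <= y' by rewrite -(pmulr_lge0 _ rn); lra.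
by apply: (le_trans Hn); apply: (le_trans Ln); nra.
Qed.

Hypothesis H_ge_max : forall e, 0 < e -> exists t0, forall t n, t0 <= t ->
  rho n <= t -> t <= rho n.+1 ->
  Num.min (L n.+1) (L n + D * (t - rho n)) - e * t <= H t.

(** Both branches of the minimum stay above z t: the first since L_(n+1) >= z rho_(n+1), the second
    since it starts above z rho_n and has slope D >= z. *)
Lemma eventually_ge (y : R) :
  (y%:E < limn_einf (fun n => (L n / rho n)%:E))%E ->
  exists t0, forall t, t0 <= t -> 0 < t -> y * t <= H t.
Proof.
move=> /lte_real_between[y' /andP[+ hy']]; rewrite lte_fin => yy'.
have [n0 hn0] := lt_limn_einf_eventually hy'.
have e0 : 0 < y' - y by lra.
have [t1 ht1] := H_ge_max e0.
exists (Num.max (rho n0.+1) t1) => t; rewrite ge_max => /andP[h1 h2] tp.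
have [n n0n /andP[tn tn1]] := rho_bracket h1.
have rn k : (0 < k)%N -> 0 < rho k.
  move=> k0; have := rho_ge k; have : 0 < k%:R * a by rewrite mulr_gt0// ltr0n.
  lra.
have np : (0 < n)%N := leq_trans (ltn0Sn _) n0n.
have Hn := ht1 t n h2 tn (ltW tn1).
have := hn0 n (ltnW n0n); rewrite ler_pdivlMr ?rn// => Ln.
have := hn0 n.+1 (leqW (ltnW n0n)); rewrite ler_pdivlMr ?rn// => Ln1.
have rp := rn n np.
have yD : y' <= D by rewrite -(ler_pM2r rp); apply: (le_trans Ln (LD n)).
pose z := Num.max y' 0.
have zy' : y' <= z by rewrite le_max lexx.
have z0 : 0 <= z by rewrite le_max lexx orbT.
have zD : z <= D by rewrite ge_max yD ltW.
have Lz : z * rho n <= L n.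
  by rewrite /z; case: (leP y' 0) => _ //; rewrite mul0r.
have Lz1 : z * rho n.+1 <= L n.+1.
  by rewrite /z; case: (leP y' 0) => _ //; rewrite mul0r.
have : z * t <= Num.min (L n.+1) (L n + D * (t - rho n)).
  rewrite le_min; apply/andP; split; nra.
nra.
Qed.

(** The two branches of the minimum meet at [high n], with common value L_(n+1). *)
Lemma frequently_ge_high (y t0 : R) :
  (y%:E < limn_esup (fun n => (L n.+1 / high n)%:E))%E ->
  exists t, [/\ t0 <= t, 0 < t & y * t <= H t].
Proof.
move=> /lte_real_between[y' /andP[+ hy']]; rewrite lte_fin => yy'.
have e0 : 0 < y' - y by lra.
have [t1 ht1] := H_ge_max e0.
have [n0 hn0] := rho_unbounded (Num.max t0 (Num.max 1 t1)).
have [n nn0] := lt_limn_esup_frequently hy' n0.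
have := hn0 n nn0; rewrite !ge_max => /and3P[h1 h2 h3].
have rh := rho_high n; have hr := high_rho n; have hp : 0 < high n by lra.
rewrite ler_pdivlMr// => Ln; exists (high n); split; [lra|lra|].
have th : t1 <= high n by lra.
have := ht1 (high n) n th rh hr.
rewrite (_ : L n + D * (high n - rho n) = L n.+1) ?minxx; first by lra.
by rewrite LS mulrBr mul_high; lra.
Qed.

Hypothesis H_le_max : forall e, 0 < e -> exists t0, forall t n, t0 <= t ->
  rho n <= t -> H t <= L n + D * (t - rho n) + e * t.

(** Before [high n] the sloped bound of level n applies. After it H is compared by monotonicity with
    its value at rho_(n+1) - c, or at rho_(n+1) when t is within c of that point. *)
Lemma eventually_le_high (y : R) :
  (limn_esup (fun n => (L n.+1 / high n)%:E) < y%:E)%E ->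
  exists t0, forall t, t0 <= t -> 0 < t -> H t <= y * t.
Proof.
have cge := c0.
move=> /lte_real_between[y' /andP[hy']]; rewrite lte_fin => yy'.
(* Half the gap: in the last case the error is e rho_(n+1), which is at most 2 e t because t >=
   c. *)
have e0 : 0 < (y - y') / 2 by rewrite divr_gt0// subr_gt0.
have [t1 ht1] := H_le_max e0.
have [n0 hn0] := limn_esup_lt_eventually hy'.
exists (Num.max (rho n0.+1) (Num.max t1 c)) => t.
rewrite !ge_max => /and3P[h1 h2 h3] tp.
have [n n0n /andP[tn tn1]] := rho_bracket h1.
have rn : 0 < rho n.
  have := rho_ge n; have : 0 < n%:R * a by rewrite mulr_gt0// ltr0n (leq_trans _ n0n).
  lra.
have rh := rho_high n; have hr := high_rho n; have hp : 0 < high n by lra.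
have := hn0 n (ltnW n0n); rewrite ler_pdivrMr// => Ln.
have LDh : L n.+1 <= D * high n by rewrite mul_high LS lerD2r LD.
pose z := Num.min y' D.
have zy' : z <= y' by rewrite ge_min lexx.
have zD : z <= D by rewrite ge_min lexx orbT.
have Lz : L n.+1 <= z * high n by rewrite /z; case: (leP y' D).
have z0 : 0 <= z by rewrite -(pmulr_lge0 _ hp); apply: le_trans (L0 _) Lz.
set e := (y - y') / 2 in e0 ht1; have ye : y = y' + 2 * e by rewrite /e; lra.
have [th|ht] := leP t (high n).
  apply: (le_trans (ht1 t n h2 tn)).
  have := mul_high n; have := LS n; nra.
have Lt : L n.+1 <= z * t by apply: (le_trans Lz); rewrite ler_wpM2l// ltW.
have [tc|ct] := leP t (rho n.+1 - c).
  by apply: (le_trans (le_trans (H_nd tc) (H_le n.+1))); nra.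
have t1n : t1 <= rho n.+1 by lra.
have := ht1 (rho n.+1) n.+1 t1n (lexx _); rewrite subrr mulr0 addr0 => Hn.
apply: (le_trans (le_trans (H_nd (ltW tn1)) Hn)).
have : e * rho n.+1 <= e * (t + t) by rewrite ler_pM2l//; lra.
nra.
Qed.

End asymptotics.

(** * Logarithms of the construction parameters *)

Section log_scales.
Variables (R : realType) (d : nat) (M N : nat -> nat).
Hypothesis hd : (1 <= d)%N.
Hypothesis hM : forall k, (1 <= k)%N -> (2 <= M k)%N.
Hypothesis hN : forall k, (1 <= k)%N -> (1 <= N k <= M k ^ d)%N.

Definition log_count n : R := ln (nb_cubes N n)%:R.
Definition log_res n : R := - ln (side R M n).
Definition log_step n : R := ln (N n.+1)%:R.

Lemma log_resE n : log_res n = ln (res M n)%:R.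
Proof. by rewrite /log_res /side lnV ?opprK// posrE ltr0n (res_gt0 hM). Qed.

Lemma d_gt0 : 0 < d%:R :> R.
Proof. by rewrite ltr0n. Qed.

Lemma log_count_ge0 n : 0 <= log_count n.
Proof. by rewrite ln_ge0// ler1n (nb_cubes_gt0 hN). Qed.

Lemma log_res0 : log_res 0 = 0.
Proof. by rewrite log_resE res0 ln1. Qed.

Lemma nb_cubes_le n : (nb_cubes N n <= res M n ^ d)%N.
Proof.
elim: n => [|n IHn]; first by rewrite nb_cubes0 res0 exp1n.
by rewrite nb_cubesS resS expnMn leq_mul//; have /andP[] := hN (ltn0Sn n).
Qed.

Lemma ln_le (u v : R) : 0 < u -> u <= v -> ln u <= ln v.
Proof. by move=> u0 uv; rewrite ler_ln ?posrE// (lt_le_trans u0). Qed.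

Lemma log_count_le n : log_count n <= d%:R * log_res n.
Proof.
rewrite log_resE mulr_natl -lnXn ?ltr0n ?(res_gt0 hM)//.
by rewrite ln_le ?ltr0n ?(nb_cubes_gt0 hN)// -natrX ler_nat nb_cubes_le.
Qed.

Lemma N_gt0 n : (0 < N n.+1)%N.
Proof. by have /andP[] := hN (ltn0Sn n). Qed.

Lemma log_countS n : log_count n.+1 = log_count n + log_step n.
Proof.
by rewrite /log_count nb_cubesS natrM lnM ?posrE ?ltr0n ?(nb_cubes_gt0 hN) ?N_gt0.
Qed.

Lemma log_step_ge0 n : 0 <= log_step n.
Proof. by rewrite ln_ge0// ler1n N_gt0. Qed.

Lemma log_resS n : log_res n.+1 = log_res n + ln (M n.+1)%:R.
Proof.
rewrite !log_resE resS natrM lnM ?posrE ?ltr0n ?(res_gt0 hM)//.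
exact: leq_trans (hM _).
Qed.

Lemma log_step_le n : d%:R^-1 * log_step n <= log_res n.+1 - log_res n.
Proof.
have M0 : (0 < M n.+1)%N by exact: leq_trans (hM _).
rewrite log_resS addrC addKr ler_pdivrMl ?d_gt0// mulr_natl -lnXn ?ltr0n//.
rewrite ln_le ?ltr0n ?N_gt0// -natrX ler_nat.
by have /andP[] := hN (ltn0Sn n).
Qed.

Lemma ln2_gt0 : 0 < ln 2 :> R.
Proof. by rewrite ln_gt0// ltr1n. Qed.

Lemma log_res_ge n : n%:R * ln 2 <= log_res n.
Proof.
elim: n => [|n IHn]; first by rewrite mul0r log_res0.
rewrite log_resS -natr1 mulrDl mul1r lerD// ln_le// ler_nat; exact: hM.
Qed.

Lemma side_expR n : side R M n = expR (- log_res n).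
Proof. by rewrite /log_res opprK lnK// posrE side_gt0. Qed.

Lemma inv_nb_cubes_expR n : (nb_cubes N n)%:R^-1 = expR (- log_count n) :> R.
Proof. by rewrite expRN lnK// posrE ltr0n (nb_cubes_gt0 hN). Qed.

End log_scales.

Section weight_growth.
Variable R : realType.

(** [weight m] is at most (m + 2)^3, and ln (f k) <= f k - 1 with f = e / 3 gives an arbitrarily
    small slope. *)
Lemma ln_weight_le (e : R) : 0 < e -> exists K, forall m,
  ln (weight R m) <= e * m%:R + K.
Proof.
move=> e0; pose f := e / 3; have f0 : 0 < f by rewrite divr_gt0.
exists (3 * (2 * f - 1 - ln f)) => m.
have m0 : 0 < m.+2%:R :> R by rewrite ltr0n.
have h1 : ln (weight R m) <= 3 * ln m.+2%:R.
  rewrite mulr_natl -lnXn// ln_le ?weight_gt0// -natrX ler_nat.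
  by rewrite [leqRHS]expnS mulnC leq_mul// leq_exp2r.
have h2 : ln f + ln m.+2%:R <= f * m.+2%:R - 1.
  rewrite -lnM ?posrE//.
  have := @le_ln1Dx R (f * m.+2%:R - 1); rewrite addrCA subrr addr0; apply.
  by rewrite ltrBrDr addrC subrr mulr_gt0.
have h3 : f * m.+2%:R = f * m%:R + 2 * f by rewrite -addn2 natrD; ring.
have h4 : e * m%:R = 3 * (f * m%:R) by rewrite /f; field.
lra.
Qed.

End weight_growth.

(** * Bounds on the logarithmic mass at a point of the Cantor set *)

Section cantor_points.
Variables (R : realType) (d : nat) (M N : nat -> nat).
Hypothesis hd : (1 <= d)%N.
Hypothesis hM : forall k, (1 <= k)%N -> (2 <= M k)%N.
Hypothesis hN : forall k, (1 <= k)%N -> (1 <= N k <= M k ^ d)%N.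
Variables (E : Omega hN) (mu : {measure set (Rn R d) -> \bar R}).
Hypothesis hmu : natural_measure E mu.
Variable x : Rn R d.
Hypothesis hx : cantor_set E x.

Local Notation s := (side R M).
Local Notation L := (log_count R N).
Local Notation rho := (log_res R M).

Lemma cantor_level n : level_set E n x.
Proof.
case: n => [|n]; last exact: hx.
have [Q QE Qx] := hx (ltn0Sn 0); exists (parent Q).
  exact: (parent_in (svalP E) QE).
exact: cube_set_parent.
Qed.

Lemma mu_cball_ge n r : 2 * d%:R * s n <= r ->
  ((nb_cubes N n)%:R^-1%:E <= mu (cball x r))%E.
Proof.
move=> dr; have [Q QE Qx] := cantor_level n; have s0 := side_gt0 R hM n.
apply: le_trans (mu_sup_ball_ge hM hmu QE Qx) _.
apply: le_measure; rewrite ?inE.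
- exact: measurable_sup_ball.
- exact: measurable_cball.
have s20 : 0 <= 2 * s n by rewrite mulr_ge0// ltW.
apply: subset_trans (@sup_ball_sub_cball R d x _ s20) _; apply: sub_cball.
by rewrite mulrCA mulrA.
Qed.

Lemma mu_cball_le n j r : 0 <= r -> r < j%:R * s n ->
  (mu (cball x r) <= ((j.+1.*2.+1 ^ d)%:R / (nb_cubes N n)%:R)%:E)%E.
Proof.
move=> r0 rj; have [Q QE Qx] := cantor_level n.
apply: le_trans (mu_sup_ball_le hM hmu Qx rj); apply: le_measure; rewrite ?inE.
- exact: measurable_cball.
- exact: measurable_sup_ball.
- exact: cball_sub_sup_ball.
Qed.

(** Positivity uses a level so deep that 2 d r_n <= r, finiteness the count at level 0. *)
Lemma mu_cball_fin r : 0 < r -> (0 < mu (cball x r) < +oo)%E.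
Proof.
move=> r0; have l2 := @ln2_gt0 R; apply/andP; split.
  have [n hn] : exists n, 2 * d%:R * s n <= r.
    pose n := Num.bound (`|ln (2 * d%:R / r) / ln 2|).
    have dr0 : 0 < 2 * d%:R / r by rewrite divr_gt0// mulr_gt0// ltr0n.
    exists n; rewrite side_expR// expRN ler_pdivrMr ?expR_gt0// [leRHS]mulrC -ler_pdivrMr//.
    rewrite -[leLHS]lnK ?posrE// ler_expR; apply: le_trans (log_res_ge R hM n).
    rewrite -ler_pdivrMr//; apply: le_trans (ler_norm _) _; apply: ltW.
    by apply: archi_boundP.
  apply: lt_le_trans (mu_cball_ge hn).
  by rewrite lte_fin invr_gt0 ltr0n (nb_cubes_gt0 hN).
have rj : r < (Num.truncn (r / s 0)).+1%:R * s 0.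
  rewrite -ltr_pdivrMr ?side_gt0//; apply: truncnS_gt.
by apply: le_lt_trans (mu_cball_le (ltW r0) rj) _; rewrite ltry.
Qed.

Local Notation H := (log_mass mu x).
(** The two bounded errors: 2d is the radius factor in [mu_cball_ge], and 7^d the neighbour count in
    [mu_cball_le] with j = 2. *)
Let c : R := ln (2 * d%:R).
Let C : R := d%:R * ln 7.

Lemma log_mass_coarse_le n : H (rho n - c) <= L n.
Proof.
rewrite (log_mass_le mu_cball_fin) -(inv_nb_cubes_expR R hN).
apply: mu_cball_ge; rewrite opprB expRD -side_expR// lnK ?posrE//.
by rewrite mulr_gt0// ltr0n.
Qed.

Lemma expR_pow (k : nat) (t : R) : (expR t) ^+ k = expR (k%:R * t).
Proof. by rewrite mulrC expRM_natr. Qed.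

Lemma seven_pow : (7 ^ d)%:R = expR C.
Proof. by rewrite natrX -[X in X ^+ d](@lnK R 7) ?posrE// expR_pow. Qed.

Lemma log_mass_fine_ge n t : rho n <= t -> L n - C <= H t.
Proof.
move=> nt; rewrite (log_mass_ge mu_cball_fin).
have tr : expR (- t) < 2%:R * s n.
  rewrite side_expR//; apply: (@le_lt_trans _ _ (expR (- rho n))).
    by rewrite ler_expR lerN2.
  by rewrite ltr_pMl ?expR_gt0// ltr1n.
apply: le_trans (mu_cball_le (expR_ge0 _) tr) _.
by rewrite lee_fin (inv_nb_cubes_expR R hN) seven_pow -expRD ler_expR; lra.
Qed.

Lemma log_mass_coarse_ge n t : t <= rho n -> L n - d%:R * (rho n - t) - C <= H t.
Proof.
move=> tn; rewrite (log_mass_ge mu_cball_fin).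
pose q := expR (rho n - t); have s0 := side_gt0 R hM n.
have q1 : 1 <= q by rewrite -expR0 ler_expR subr_ge0.
have rq : expR (- t) = q * s n.
  by rewrite side_expR// -expRD; congr expR; ring.
have /andP[jq qj] := truncn_itv (le_trans ler01 q1).
have tr : expR (- t) < (Num.truncn q).+1%:R * s n by rewrite rq ltr_pM2r.
apply: le_trans (mu_cball_le (expR_ge0 _) tr) _.
rewrite lee_fin (inv_nb_cubes_expR R hN) natrX.
apply: (@le_trans _ _ ((7 * q) ^+ d * expR (- L n))).
  rewrite ler_wpM2r ?expR_ge0// lerXn2r ?nnegrE ?mulr_ge0 ?expR_ge0//.
  (* The base is 2 floor(q) + 5, at most 7 q because q >= 1. *)
  rewrite -muln2 -natr1 natrM -addn2 natrD; lra.
rewrite exprMn -natrX seven_pow expR_pow -!expRD ler_expR; lra.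
Qed.

Lemma expR_ln2 m : expR (m%:R * ln 2) = 2 ^+ m :> R.
Proof. by rewrite -expR_pow lnK// posrE. Qed.

(** Passes from dyadic sup-balls to all radii; the constants and [ln (weight R m)] are absorbed in e
    t. *)
Lemma log_mass_le_max :
  (exists m0, forall m n, (m0 <= m)%N -> (n <= m)%N -> level_set E n x ->
  (((weight R m)^-1 / (nb_cubes N n * (2 ^ m %/ res M n).+1 ^ d)%:R)%:E <
   mu (sup_ball x (2 ^- m)))%E) ->
  forall e, 0 < e -> exists t0, forall t n, t0 <= t ->
  rho n <= t -> H t <= L n + d%:R * (t - rho n) + e * t.
Proof.
move=> [m0 hm0] e e0; have l2 := @ln2_gt0 R.
have lnd : 0 <= ln d%:R :> R by rewrite ln_ge0// ler1n.
have D0 : 0 <= d%:R :> R by [].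
have f0 : 0 < e * ln 2 / 2 by rewrite divr_gt0// mulr_gt0.
have [K hK] := ln_weight_le f0.
pose B := ln d%:R + ln 2 : R.
(* The first two terms come from the weight at m ln 2 <= t + B, the last from the number of
   subcubes. *)
pose K' := e / 2 * B + K + d%:R * (B + ln 2).
exists (Num.max (m0%:R * ln 2) (K' * (2 / e))) => t n; rewrite ge_max => /andP[h1 h2] nt.
have {}h2 : K' <= e / 2 * t.
  by move: h2; rewrite -(invf_div e 2) -[_ * _^-1]/(_ / _) ler_pdivrMr ?divr_gt0// mulrC.
have t0 : 0 <= t by apply: le_trans h1; rewrite mulr_ge0// ltW.
have tl0 : 0 <= (t + ln d%:R) / ln 2 by rewrite divr_ge0 ?addr_ge0// ltW.
(* The first dyadic scale with d 2^-m < e^-t, so that the sup-ball fits in the Euclidean ball. *)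
pose m := (Num.truncn ((t + ln d%:R) / ln 2)).+1.
have /andP[] := truncn_itv tl0; rewrite -/m ler_pdivlMr// ltr_pdivrMr// => mt tm.
have {mt}mt : m%:R * ln 2 <= t + B.
  by rewrite /m -natr1 mulrDl mul1r /B addrA lerD2r.
have nm : (n <= m)%N.
  rewrite -(ler_nat R) -(ler_pM2r l2); have := log_res_ge R hM n; lra.
have m0m : (m0 <= m)%N by rewrite -(ler_nat R) -(ler_pM2r l2); lra.
have := hm0 m n m0m nm (cantor_level n) => /ltW lt_mu.
rewrite (log_mass_le mu_cball_fin).
have sub : sup_ball x (2 ^- m) `<=` cball x (expR (- t)).
  have p0 : 0 <= 2 ^- m :> R by rewrite invr_ge0 exprn_ge0.
  apply: subset_trans (@sup_ball_sub_cball R d x _ p0) _; apply: sub_cball.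
  rewrite -expR_ln2 -expRN -[X in X * _](@lnK R) ?posrE ?ltr0n//.
  by rewrite -expRD ler_expR; lra.
have mono : (mu (sup_ball x (2 ^- m)) <= mu (cball x (expR (- t))))%E.
  apply: le_measure; rewrite ?inE //.
    exact: measurable_sup_ball.
  exact: measurable_cball.
apply: le_trans (le_trans lt_mu mono); rewrite lee_fin.
have rs0 := res_gt0 hM n.
(* Since [res M n] <= 2^m, adding 1 to the quotient at most doubles it. *)
have jle : (2 ^ m %/ res M n).+1%:R <= expR (ln 2 + m%:R * ln 2 - rho n).
  rewrite expRD expRN (log_resE _ hM) lnK ?posrE ?ltr0n//.
  rewrite ler_pdivlMr ?ltr0n// expRD expR_ln2 lnK ?posrE//.
  rewrite -natrX -!natrM ler_nat mulSn mul2n -addnn leq_add ?leq_divM//.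
  rewrite -(ler_nat R) natrX -expR_ln2 -[leLHS]lnK ?posrE ?ltr0n// -(log_resE _ hM).
  by rewrite ler_expR; lra.
apply: (@le_trans _ _ (expR (- ln (weight R m) - L n -
    d%:R * (ln 2 + m%:R * ln 2 - rho n)))).
  rewrite ler_expR; have := hK m.
  have : e * ln 2 / 2 * m%:R <= e / 2 * (t + B).
    rewrite (_ : e * ln 2 / 2 * m%:R = e / 2 * (m%:R * ln 2)); last by ring.
    by rewrite ler_pM2l// divr_gt0.
  have : d%:R * (ln 2 + m%:R * ln 2 - rho n) <= d%:R * (ln 2 + (t + B) - rho n).
    by rewrite ler_wpM2l// lerB// lerD2l.
  move: h2; rewrite /K'; nra.
rewrite !expRD !expRN lnK ?posrE ?weight_gt0// -mulrA ler_pM2l ?invr_gt0 ?weight_gt0//.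
rewrite natrM invfM -expRN -(inv_nb_cubes_expR R hN).
rewrite ler_pM2l ?invr_gt0 ?ltr0n ?(nb_cubes_gt0 hN)//.
rewrite natrX lef_pV2 ?posrE ?exprn_gt0 ?ltr0n ?expR_gt0//.
by rewrite -expR_pow lerXn2r ?nnegrE ?expR_ge0.
Qed.

(** Divided by P_(n+1), the two terms of [near_mean] become 1 / P_(n+1) and, up to a constant, (r /
    r_n)^d / P_n. Their sum is at most twice the larger, hence the minimum of the logarithms. *)
Lemma log_mass_ge_max :
  (exists m0, forall m n, (m0 <= m)%N -> (n <= m)%N -> level_set E n.+1 x ->
    (mu (sup_ball x (2 ^- m)) <=
     (weight R m * near_mean R d M N n m / (nb_cubes N n.+1)%:R)%:E)%E) ->
  forall e, 0 < e -> exists t0, forall t n, t0 <= t ->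
  rho n <= t -> t <= rho n.+1 ->
  Num.min (L n.+1) (L n + d%:R * (t - rho n)) - e * t <= H t.
Proof.
move=> [m0 hm0] e e0; have l2 := @ln2_gt0 R.
have D0 : 0 <= d%:R :> R by [].
have C0 : 0 <= C by rewrite mulr_ge0// ln_ge0// ler1n.
have f0 : 0 < e * ln 2 / 2 by rewrite divr_gt0// mulr_gt0.
have [K hK] := ln_weight_le f0.
pose K' := K + d%:R * ln 2 + C + ln 2.
(* Rounding t / ln 2 down loses less than 1, whence [m0.+1]. In [K'] the final ln 2 pays for the sum
   of two terms. *)
exists (Num.max ((m0.+1)%:R * ln 2) (K' * (2 / e))) => t n.
rewrite ge_max => /andP[h1 h2] nt tn.
have {}h2 : K' <= e / 2 * t.
  by move: h2; rewrite -(invf_div e 2) -[_ * _^-1]/(_ / _) ler_pdivrMr ?divr_gt0// mulrC.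
have t0 : 0 <= t by apply: le_trans h1; rewrite mulr_ge0// ltW.
have tl0 : 0 <= t / ln 2 by rewrite divr_ge0// ltW.
pose m := Num.truncn (t / ln 2).
have /andP[] := truncn_itv tl0; rewrite -/m ler_pdivlMr// ltr_pdivrMr// => mt tm.
have nm : (n <= m)%N.
  rewrite -ltnS -(ltr_nat R) -(ltr_pM2r l2); have := log_res_ge R hM n; lra.
have m0m : (m0 <= m)%N.
  by rewrite -ltnS -(ltr_nat R) -(ltr_pM2r l2); move: h1; rewrite -natr1; lra.
have le_mu := hm0 m n m0m nm (cantor_level n.+1).
rewrite (log_mass_ge mu_cball_fin).
have mono : (mu (cball x (expR (- t))) <= mu (sup_ball x (2 ^- m)))%E.
  apply: le_measure; rewrite ?inE //.
  - exact: measurable_cball.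
  - exact: measurable_sup_ball.
  apply: subset_trans (@cball_sub_sup_ball R d x _ (expR_ge0 _)) _; apply: sub_sup_ball.
  by rewrite -expR_ln2 -expRN ler_expR lerN2.
apply: le_trans mono (le_trans le_mu _); rewrite lee_fin.
have rs0 := res_gt0 hM n; have rs1 := res_gt0 hM n.+1.
have rhoS := log_resS R hM n.
have M0 : (0 < M n.+1)%N by exact: leq_trans (hM _).
have M0R : 0 < (M n.+1)%:R :> R by rewrite ltr0n.
(* The ratio 2^-m / r_(n+1), at least 1 because t <= rho_(n+1). *)
pose q : R := expR (rho n.+1 - m%:R * ln 2).
have q1 : 1 <= q by rewrite -expR0 ler_expR subr_ge0; lra.
have iq : (near_radius M n m).*2.+1%:R <= 7 * q.
  have hq : (res M n.+1 %/ 2 ^ m)%:R <= q.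
    rewrite /q expRD expRN expR_ln2 (log_resE _ hM) lnK ?posrE ?ltr0n//.
    by rewrite ler_pdivlMr ?exprn_gt0// -natrX -natrM ler_nat leq_divM.
  rewrite /near_radius -muln2 -natr1 natrM -addn2 natrD; lra.
pose u := Num.min (L n.+1) (L n + d%:R * (t - rho n)).
have h1' : (nb_cubes N n.+1)%:R^-1 <= expR (- u + d%:R * ln 2 + C) :> R.
  rewrite (inv_nb_cubes_expR R hN) ler_expR.
  have : u <= L n.+1 by rewrite ge_min lexx.
  have : 0 <= d%:R * ln 2 :> R by rewrite mulr_ge0// ltW.
  lra.
have h2' : ((near_radius M n m).*2.+1 ^ d)%:R * (N n.+1)%:R / (M n.+1 ^ d)%:R
    / (nb_cubes N n.+1)%:R <= expR (- u + d%:R * ln 2 + C) :> R.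
  (* The factor N_(n+1) cancels against P_(n+1) = P_n N_(n+1). *)
  have -> : ((near_radius M n m).*2.+1 ^ d)%:R * (N n.+1)%:R / (M n.+1 ^ d)%:R
      / (nb_cubes N n.+1)%:R =
      ((near_radius M n m).*2.+1 ^ d)%:R * ((M n.+1)%:R^-1 ^+ d) * (nb_cubes N n)%:R^-1 :> R.
    rewrite nb_cubesS natrM [(M _ ^ d)%:R]natrX exprVn.
    have Nn0 : (N n.+1)%:R != 0 :> R by rewrite pnatr_eq0 -lt0n (N_gt0 hN).
    have nb0 : (nb_cubes N n)%:R != 0 :> R by rewrite pnatr_eq0 -lt0n (nb_cubes_gt0 hN).
    have Mn0 : (M n.+1)%:R ^+ d != 0 :> R by rewrite expf_neq0// gt_eqF.
    move: Nn0 nb0 Mn0; move: ((N n.+1)%:R) ((nb_cubes N n)%:R) (_ ^+ d).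
    by move=> v w z Nn0 nb0 Mn0; field; rewrite Nn0 nb0 Mn0.
  apply: (@le_trans _ _ ((7 * q) ^+ d * ((M n.+1)%:R^-1 ^+ d) * expR (- L n))).
    rewrite -(inv_nb_cubes_expR R hN) ler_wpM2r ?invr_ge0// ler_wpM2r ?exprn_ge0 ?invr_ge0//.
    by rewrite natrX lerXn2r ?nnegrE ?mulr_ge0 ?expR_ge0.
  rewrite -[(M n.+1)%:R]lnK ?posrE// -expRN exprMn -natrX seven_pow !expR_pow -!expRD.
  rewrite ler_expR.
  have : u <= L n + d%:R * (t - rho n) by rewrite ge_min lexx orbT.
  have : d%:R * t <= d%:R * (m%:R * ln 2 + ln 2).
    by rewrite ler_wpM2l// ltW// (lt_le_trans tm)// -natr1 mulrDl mul1r.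
  rewrite rhoS; lra.
apply: (@le_trans _ _ (weight R m * (2 * expR (- u + d%:R * ln 2 + C)))).
  rewrite -mulrA ler_pM2l ?weight_gt0// /near_mean mulrDl mul1r.
  by apply: (le_trans (lerD h1' h2')); rewrite [leRHS]mulr_natl mulr2n.
rewrite -[weight R m]lnK ?posrE ?weight_gt0// -[X in _ * (X * _)](@lnK R 2) ?posrE//.
rewrite -!expRD ler_expR; have := hK m.
have : e * ln 2 / 2 * m%:R <= e / 2 * t.
  rewrite (_ : e * ln 2 / 2 * m%:R = e / 2 * (m%:R * ln 2)); last by ring.
  by rewrite ler_pM2l// divr_gt0.
move: h2; rewrite /K' -/u; lra.
Qed.

End cantor_points.

(** * Bounds on the local dimensions *)

Section dimensions.
Variables (R : realType) (d : nat) (M N : nat -> nat).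
Hypothesis hd : (1 <= d)%N.
Hypothesis hM : forall k, (1 <= k)%N -> (2 <= M k)%N.
Hypothesis hN : forall k, (1 <= k)%N -> (1 <= N k <= M k ^ d)%N.
Variables (E : Omega hN) (mu : {measure set (Rn R d) -> \bar R}).
Hypothesis hmu : natural_measure E mu.

Let D0 : 0 < d%:R :> R := d_gt0 R hd.
Let a0 := @ln2_gt0 R.
Let L0 := log_count_ge0 R hN.
Let LD := log_count_le R hM hN.
Let LS := log_countS R hN.
Let rho_ge := log_res_ge R hM.
Let nu0 := log_step_ge0 R hN.
Let nuD := log_step_le R hd hM hN.

Lemma log_shift_ge0 : 0 <= ln (2 * d%:R) :> R.
Proof. by rewrite ln_ge0// -natrM ler1n muln_gt0. Qed.

Let c0 := log_shift_ge0.

Section at_point.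
Variable x : Rn R d.
Hypothesis hx : cantor_set E x.

Let fin := mu_cball_fin hd hM hmu hx.
Let H_nd := log_mass_nondecreasing fin.
Let H_le := log_mass_coarse_le hd hM hmu hx.
Let H_ge_fine := log_mass_fine_ge hd hM hmu hx.
Let H_ge_coarse := log_mass_coarse_ge hd hM hmu hx.

Lemma t_star_le_lower_dim : (t_star R d M N <= lower_dim mu x)%E.
Proof.
apply: (lower_dim_ge fin) => y.
exact: (eventually_ge_low D0 a0 L0 LD LS rho_ge nu0 nuD H_ge_fine H_ge_coarse).
Qed.

Lemma lower_dim_le_s_1 : (lower_dim mu x <= s_1 R M N)%E.
Proof.
apply: (lower_dim_le fin) => y t0; exact: (frequently_le a0 rho_ge c0 H_le).
Qed.

Lemma s_star_le_upper_dim : (s_star R M N <= upper_dim mu x)%E.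
Proof.
apply: (upper_dim_ge fin) => y t0; exact: (frequently_ge a0 rho_ge H_ge_fine).
Qed.

Lemma upper_dim_le_s_starstar : (upper_dim mu x <= s_starstar R M N)%E.
Proof.
apply: (upper_dim_le fin) => y.
exact: (eventually_le_next D0 a0 L0 rho_ge nu0 nuD H_nd c0 H_le).
Qed.

Lemma upper_dim_le_s_2 :
  (exists m0, forall m n, (m0 <= m)%N -> (n <= m)%N -> level_set E n x ->
    (((weight R m)^-1 / (nb_cubes N n * (2 ^ m %/ res M n).+1 ^ d)%:R)%:E <
     mu (sup_ball x (2 ^- m)))%E) ->
  (upper_dim mu x <= s_2 R d M N)%E.
Proof.
move=> /(log_mass_le_max hd hM hmu hx) H_le_max.
apply: (upper_dim_le fin) => y.
exact: (eventually_le_high D0 a0 L0 LD LS rho_ge nu0 nuD H_nd c0 H_le H_le_max).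
Qed.

Hypothesis near_le : exists m0, forall m n, (m0 <= m)%N -> (n <= m)%N ->
  level_set E n.+1 x ->
  (mu (sup_ball x (2 ^- m)) <=
   (weight R m * near_mean R d M N n m / (nb_cubes N n.+1)%:R)%:E)%E.

Lemma s_1_le_lower_dim : (s_1 R M N <= lower_dim mu x)%E.
Proof.
have H_ge_max := log_mass_ge_max hd hM hmu hx near_le.
apply: (lower_dim_ge fin) => y.
exact: (eventually_ge D0 a0 L0 LD rho_ge nu0 nuD H_ge_max).
Qed.

Lemma s_2_le_upper_dim : (s_2 R d M N <= upper_dim mu x)%E.
Proof.
have H_ge_max := log_mass_ge_max hd hM hmu hx near_le.
apply: (upper_dim_ge fin) => y t0.
exact: (frequently_ge_high D0 a0 LS rho_ge nu0 nuD H_ge_max).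
Qed.

End at_point.

End dimensions.

Theorem theorem1p4 (R : realType) (d : nat) (hd : (1 <= d)%N)
    (M N : nat -> nat)
    (hM : forall k, (1 <= k)%N -> (2 <= M k)%N)
    (hN : forall k, (1 <= k)%N -> (1 <= N k <= M k ^ d)%N)
    (P : probability (Omega hN) R) (hP : random_cantor_law P) :
  (forall (E : Omega hN) (mu : {measure set (Rn R d) -> \bar R}),
     natural_measure E mu ->
     forall x, cantor_set E x ->
       (t_star R d M N <= lower_dim mu x <= s_1 R M N)%E) /\
  (forall (E : Omega hN) (mu : {measure set (Rn R d) -> \bar R}),
     natural_measure E mu ->
     forall x, cantor_set E x ->
       (s_star R M N <= upper_dim mu x <= s_starstar R M N)%E) /\
  {ae P, forall E : Omega hN,
     forall mu : {measure set (Rn R d) -> \bar R}, natural_measure E mu ->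
       {ae mu, forall x, cantor_set E x -> lower_dim mu x = s_1 R M N}} /\
  {ae P, forall E : Omega hN,
     forall mu : {measure set (Rn R d) -> \bar R}, natural_measure E mu ->
       {ae mu, forall x, cantor_set E x -> upper_dim mu x = s_2 R d M N}}.
Proof.
split.
  move=> E mu hmu x hx; apply/andP; split.
    exact: (t_star_le_lower_dim hd hM hmu hx).
  exact: (lower_dim_le_s_1 hd hM hmu hx).
split.
  move=> E mu hmu x hx; apply/andP; split.
    exact: (s_star_le_upper_dim hd hM hmu hx).
  exact: (upper_dim_le_s_starstar hd hM hmu hx).
split.
  (* The exceptional outcomes depend on the cube counts alone, so they are fixed before [mu] is
     introduced. *)
  have := ae_near_excess_summable hP; apply: filterS => E hE mu hmu.
  have := ae_mu_sup_ball_le hM hmu hE; apply: filterS => x near_le hx.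
  apply/eqP; rewrite eq_le; apply/andP; split.
    exact: (lower_dim_le_s_1 hd hM hmu hx).
  exact: (s_1_le_lower_dim hd hM hmu hx near_le).
have := ae_near_excess_summable hP; apply: filterS => E hE mu hmu.
have := ae_mu_sup_ball_gt hM E mu; have := ae_mu_sup_ball_le hM hmu hE.
apply: filterS2 => x near_le ball_gt hx; apply/eqP; rewrite eq_le; apply/andP; split.
  exact: (upper_dim_le_s_2 hd hM hmu hx ball_gt).
exact: (s_2_le_upper_dim hd hM hmu hx near_le).
Qed.
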